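(* Let $\mathcal{B}$ be a unital $C^\ast$-algebra and let $\eta:\mathcal{B}\to\mathcal{B}$ be a positive linear map (not necessarily completely positive). Fix $b\in\mathbb{H}^+(\mathcal{B})$ and let $w_\ast$ be the unique fixed point of the holomorphic function $h_b:\mathbb{H}^-(\mathcal{B})\to\mathbb{H}^-(\mathcal{B})$ defined by $h_b(w):=(b-\eta(w))^{-1}$ for every $w\in\mathbb{H}^-(\mathcal{B})$ (equivalently, $w_\ast$ is the unique solution in $\mathbb{H}^-(\mathcal{B})$ of the equation $bw=\mathbf{1}+\eta(w)w$; in other words, $w_\ast=G_s(b)$ for any centered $\mathcal{B}$-valued semicircular element $s$ with covariance $\eta$). Choose any $r>\|\operatorname{Im}(b)^{-1}\|$ and set $$\epsilon:=\min\bigl\{r-\|\operatorname{Im}(b)^{-1}\|,\ (\|b\|+r\|\eta\|)^{-2}\|\operatorname{Im}(b)^{-1}\|^{-1}\bigr\}$$ and $q:=\bigl(1+\frac{\epsilon}{2r}\bigr)^{-1}$. Let $\mathcal{D}_r:=\{w\in\mathbb{H}^-(\mathcal{B})\mid\|w\|<r\}$. Then, for each initial point $w_0\in h_b(\mathcal{D}_r)$ and all $n\ge 1$, $$\|h_b^n(w_0)-w_\ast\|\le\Bigl(\|\operatorname{Im}(b)^{-1}\|\frac{2r}{\epsilon}\Bigr)^2\|\eta\|\,\|h_b(w_0)-w_0\|\,q^{n-1}$$ and furthermore $$\|h_b^n(w_0)-w_\ast\|\le\Bigl(\|\operatorname{Im}(b)^{-1}\|\frac{2r}{\epsilon}\B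igr)^2\|\eta\|\,\|h_b^n(w_0)-h_b^{n-1}(w_0)\|.$$
   Context: For a unital $C^\ast$-algebra $\mathcal{B}$ with unit $\mathbf{1}$, put $\operatorname{Im}(b):=\frac{1}{2i}(b-b^\ast)$ and $\mathbb{H}^\pm(\mathcal{B}):=\{b\in\mathcal{B}\mid\exists\,\epsilon>0:\ \pm\operatorname{Im}(b)\ge\epsilon\mathbf{1}\}$. $h_b^n$ denotes the $n$-fold iterate of $h_b$ ($h_b^0=\mathrm{id}$), and $\|\eta\|$ is the operator norm of $\eta$. It is known (Helton, Rashidi Far, Speicher) that $h_b$ is a well-defined holomorphic self-map of $\mathbb{H}^-(\mathcal{B})$ with exactly one fixed point there. Semicircular elements (used only in the parenthetical remark): an operator-valued $C^\ast$-probability space $(\mathcal{A},\mathbb{E},\mathcal{B})$ consists of a unital $C^\ast$-algebra $\mathcal{A}$, a $C^\ast$-subalgebra $\mathcal{B}\subseteq\mathcal{A}$ containing the unit of $\mathcal{A}$, and a conditional expectation $\mathbb{E}:\mathcal{A}\to\mathcal{B}$ (positive linear, $\mathbb{E}[b]=b$ and $\mathbb{E}[b_1xb_2]=b_1\mathbb{E}[x]b_2$ for $b,b_1,b_2\in\mathcal{B}$, $x\in\mathcal{A}$). For $x=x^\ast\in\mathcal{A}$, the $\mathcal{B}$-valued Cauchy transform is $G_x:\mathbb{H}^+(\mathcal{B})\to\mathbb{H}^-(\mathcal{B})$, $G_x(b):=\mathbb{E}[(b-x)^{-1}]$. A selfadjoint $s\in\mathcal{A}$ is a centered $\mathcal{B}$-valued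 semicircular element with covariance $\eta$ if $\mathbb{E}[b_0sb_1s\cdots b_{k-1}sb_k]=\sum_{\pi\in NC_2(k)}\eta_\pi(b_0,\dots,b_k)$ for all $k\in\mathbb{N}$ and $b_0,\dots,b_k\in\mathcal{B}$, where $NC_2(k)$ is the set of non-crossing pairings of $\{1,\dots,k\}$ (empty for odd $k$) and $\eta_\pi$ is defined recursively: if $(p,p+1)$ is a block of $\pi$ and $\pi'\in NC_2(k-2)$ is obtained by removing it, then $\eta_\pi(b_0,\dots,b_k)=\eta_{\pi'}(b_0,\dots,b_{p-2},b_{p-1}\eta(b_p)b_{p+1},b_{p+2},\dots,b_k)$, with $\eta_\emptyset(b_0)=b_0$ for the empty pairing. *)

(* Defs.v *)
From HB Require Import structures.
From mathcomp Require Import all_boot all_order all_algebra.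
From mathcomp Require Import all_classical all_reals all_analysis.
From mathcomp Require Import complex.
Set Implicit Arguments.
Unset Strict Implicit.
Unset Printing Implicit Defensive.
Import Order.TTheory GRing.Theory Num.Theory.
Import numFieldNormedType.Exports.
Local Open Scope classical_set_scope.
Local Open Scope complex_scope.
Local Open Scope ring_scope.

(* The norm is a real-valued field of its own: rings and [normedModType]s
   cannot be joined in HB by any structure not below [numDomainType].
   [GRing.UnitAlgebra] supplies the unit, with 1 != 0, and the total inverse. *)
HB.mixin Record isCStarAlgebra (R : realType) A
    of GRing.UnitAlgebra R[i] A := {
  nrm : A -> R;
  nrm0_eq0 : forall x : A, nrm x = 0 -> x = 0;
  nrmD : forall x y : A, nrm (x + y) <= nrm x + nrm y;
  nrmZ : forall (a : R[i]) (x : A), nrm (a *: x) = Normc.normc a * nrm x;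
  nrmM : forall x y : A, nrm (x * y) <= nrm x * nrm y;
  nrm_complete : forall u : nat -> A,
    (forall e : R, 0 < e -> exists N : nat, forall m n : nat,
       (N <= m)%N -> (N <= n)%N -> nrm (u m - u n) < e) ->
    exists l : A, (fun n => nrm (u n - l)) @ \oo --> (0 : R);
  star : A -> A;
  starD : forall x y : A, star (x + y) = star x + star y;
  starZ : forall (a : R[i]) (x : A), star (a *: x) = conjc a *: star x;
  starM : forall x y : A, star (x * y) = star y * star x;
  starK : forall x : A, star (star x) = x;
  nrm_starM : forall x : A, nrm (star x * x) = nrm x ^+ 2
}.

#[short(type="cstarAlgType")]
HB.structure Definition CStarAlgebra (R : realType) :=
  {A of isCStarAlgebra R A & GRing.UnitAlgebra R[i] A}.

Definition cpos (R : realType) (A : cstarAlgType R) (x : A) : Prop :=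
  exists y : A, x = star y * y.

Definition cle (R : realType) (A : cstarAlgType R) (x y : A) : Prop :=
  cpos (y - x).

Definition positive_map (R : realType) (A B : cstarAlgType R)
    (f : A -> B) : Prop :=
  forall x : A, cpos x -> cpos (f x).

Definition cIm (R : realType) (A : cstarAlgType R) (x : A) : A :=
  (2 * 'i%C : R[i])^-1 *: (x - star x).

Definition Hplus (R : realType) (A : cstarAlgType R) : set A :=
  [set x | exists2 e : R, 0 < e & cle (e%:C *: 1) (cIm x)].

Definition Hminus (R : realType) (A : cstarAlgType R) : set A :=
  [set x | exists2 e : R, 0 < e & cle (e%:C *: 1) (- cIm x)].

Definition opnorm (R : realType) (A B : cstarAlgType R) (f : A -> B) : R :=
  sup [set nrm (f x) | x in [set x | nrm x <= 1]].

Definition hmap (R : realType) (B : cstarAlgType R) (eta : B -> B) (b w : B) : B :=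
  (b - eta w)^-1.

(* Complex Frechet differentiability at a point. *)
Definition cdifferentiable (R : realType) (A B : cstarAlgType R)
    (f : A -> B) (x : A) : Prop :=
  exists L : {linear A -> B},
    (exists M : R, forall v : A, nrm (L v) <= M * nrm v) /\
    forall e : R, 0 < e -> exists2 d : R, 0 < d &
      forall v : A, nrm v < d -> nrm (f (x + v) - f x - L v) <= e * nrm v.

Definition Dset (R : realType) (B : cstarAlgType R) (r : R) : set B :=
  [set w | Hminus w /\ nrm w < r].

(* The inclusion of the C*-subalgebra [B] is represented by an isometric unital
   *-homomorphism [ovemb] into the ambient algebra. *)
Record ovspace (R : realType) (B : cstarAlgType R) := OvSpace {
  ovalg :> cstarAlgType R;
  ovemb : {lrmorphism B -> ovalg};
  ovemb_star : forall c : B, ovemb (star c) = star (ovemb c);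
  ovemb_nrm : forall c : B, nrm (ovemb c) = nrm c;
  ovE : {linear ovalg -> B};
  ovE_pos : positive_map ovE;
  ovE_id : forall c : B, ovE (ovemb c) = c;
  ovE_bimod : forall (c1 c2 : B) (x : ovalg),
    ovE (ovemb c1 * x * ovemb c2) = c1 * ovE x * c2
}.

Definition cauchy_transform (R : realType) (B : cstarAlgType R)
    (A : ovspace B) (x : A) (c : B) : B :=
  ovE A ((ovemb A c - x)^-1).

Definition noncrossing (k : nat) (pi : {set {set 'I_k}}) : bool :=
  [forall i1 : 'I_k, forall j1 : 'I_k, forall i2 : 'I_k, forall j2 : 'I_k,
   forall V in pi, forall W in pi,
    [&& (i1 < j1)%N, (j1 < i2)%N, (i2 < j2)%N, i1 \in V, i2 \in V,
        j1 \in W & j2 \in W] ==> (V == W)].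

Definition NC2 (k : nat) : {set {set {set 'I_k}}} :=
  [set pi : {set {set 'I_k}} |
    [&& finset.partition pi [set: 'I_k]%SET,
        [forall V in pi, #|V| == 2%N] & noncrossing pi]].

(* The word  b_0 . b_1 . ... . b_k,  whose k dots are the positions 1, ..., k,
   is encoded as the pair of b_0 and the list of the (i, b_i).  Positions keep
   their original names when a block is removed, so that no relabelling of the
   pairing is needed.  [remove_block] removes the leftmost block formed by two
   consecutive remaining positions:
     ..., b_(p-1) . b_p . b_(p+1), ...  becomes
     ..., b_(p-1) * eta b_p * b_(p+1), ... *)
Fixpoint remove_block (R : realType) (B : cstarAlgType R) (eta : B -> B) (k : nat)
    (pi : {set {set 'I_k}}) (b0 : B) (l : seq ('I_k * B)) {struct l}
    : B * seq ('I_k * B) :=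
  match l with
  | (i, b1) :: (((j, b2) :: l2) as l1) =>
      if [set i; j]%SET \in pi then (b0 * eta b1 * b2, l2)
      else let: (c, m) := remove_block eta pi b1 l1 in (b0, (i, c) :: m)
  | _ => (b0, l)
  end.

(* A pairing of k points has k./2 blocks; the value does not depend on the
   order in which they are removed. *)
Definition eta_pi (R : realType) (B : cstarAlgType R) (eta : B -> B) (k : nat)
    (pi : {set {set 'I_k}}) (b0 : B) (bs : k.-tuple B) : B :=
  (iter k./2 (fun u => remove_block eta pi u.1 u.2) (b0, zip (enum 'I_k) bs)).1.

Definition semicircular (R : realType) (B : cstarAlgType R) (eta : B -> B)
    (A : ovspace B) (s : A) : Prop :=
  star s = s /\
  forall (k : nat) (b0 : B) (bs : k.-tuple B),
    ovE A (foldl (fun x c => x * s * ovemb A c) (ovemb A b0) bs) =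
    \sum_(pi in NC2 k) eta_pi eta pi b0 bs.

(* Main.v *)
Require Import Defs.
From HB Require Import structures.
From mathcomp Require Import all_boot all_order all_algebra.
From mathcomp Require Import all_classical all_reals all_analysis.
From mathcomp Require Import complex ring lra zify.
From Stdlib Require setoid_ring.Ncring_tac.
Set Implicit Arguments.
Unset Strict Implicit.
Unset Printing Implicit Defensive.
Import Order.TTheory GRing.Theory Num.Theory.
Import numFieldNormedType.Exports.
Local Open Scope classical_set_scope.
Local Open Scope ring_scope.

(** Write [M] for [nrm (cIm b)^-1], [E] for the operator norm of [eta], and [h]
    for the map [w |-> (b - eta w)^-1].

    The order. Positivity is existential ([x = star y * y]), so the order theory
    is built from one norm criterion: a self-adjoint [a] is positive iff
    [nrm (t - a) <= t] for some [t > 0]. This criterion makes sums of positive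
    elements positive at once; that it characterises the elements [star y * y]
    ([cposP]) needs square roots ([npos_sqrt]) and a spectral argument
    ([npos_spectrum], [npos_starM]).

    The contraction. Measure a tangent vector [v] at a point [w] of the lower
    half-plane by [nrm (y^-1/2 * v * y^-1/2)], where [y = - cIm w]. The inversion
    from the upper half-plane is an isometry: a congruence up to a unitary
    factor. The affine map [w |-> b - eta w] does not increase lengths, because
    a positive map attains its norm at the unit ([russo_dye]). Moreover the
    imaginary part [cIm b + eta y] exceeds [eta y] by at least [1 / M], whereas
    [eta y] is at most [E * r] when [nrm w <= r]; so the derivative of [h] there
    shrinks lengths by the factor [kappa r = M * E * r / (1 + M * E * r) < 1]
    ([dh_contracts]).

    The estimates. By the chain rule and the mean value inequality along a
    segment, the iterates of [h] are Lipschitz in norm with constants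
    proportional to [kappa r ^+ n] ([iter_lipschitz]); here lengths are compared
    with norms through [y <= M] at the image and [y >= s] on the segment, with
    [s = M^-1 * (nrm b + r * E) ^- 2] a lower bound for [- cIm (h w)]. A geometric
    series then gives the fixed point and both error bounds ([iterates_cvg]) with
    the factor [M / s * (M * E * r)] and the ratio [kappa r], and these constants
    are at most the announced ones ([prefactor_le], [ratio_le]). The same
    Lipschitz bound gives uniqueness.

    The semicircular element. The Cauchy transform [G] of [s] takes its values in
    the lower half-plane, so it suffices to show that [E(s * (d - s)^-1)] equals
    [eta (G d) * G d] at [d = b]. When [d] has a large imaginary part both sides
    are convergent power series, whose coefficients agree by the recursion that
    matches the first point of a noncrossing pairing with its partner
    ([semicircular_moment], [schwinger_dyson_large]). The difference of the two
    sides is analytic along the vertical half-line above [b], with a radius of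
    convergence bounded below, so it vanishes down to [b]
    ([semicircular_schwinger_dyson]). *)


(** * Identities in noncommutative rings *)

Section NoncommutativeRing.
Variable A : nzRingType.

(** These instances make the decision procedure of noncommutative rings
    available on the ring structures below. *)
#[local] Instance ncring_ops :
  @Ncring.Ring_ops A 0 1 (@GRing.add A) (@GRing.mul A) (fun x y => x - y)
    (@GRing.opp A) eq := @Ncring.Build_Ring_ops _ _ _ _ _ _ _ _.

#[local] Instance ncring_ring : @Ncring.Ring _ _ _ _ _ _ _ _ ncring_ops.
Proof.
apply: Ncring.Build_Ring.
- exact: add0r.
- exact: addrC.
- exact: addrA.
- exact: mul1r.
- exact: mulr1.
- exact: mulrA.
- exact: mulrDl.
- by move=> x y z; exact: mulrDr.
- by [].
- exact: addrN.
Qed.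

End NoncommutativeRing.

#[global] Existing Instance ncring_ops.
#[global] Existing Instance ncring_ring.

Ltac nc_ring := Ncring_tac.non_commutative_ring.

(** * Arithmetic of the norm and of the involution *)

Section CStarBasics.
Variables (R : realType) (A : cstarAlgType R).
Implicit Types (x y z : A) (s t : R).

(** The real and imaginary scalars are kept as central elements of [A], so that
    identities mixing scalars and products are identities in the ring [A]. *)
Definition sc t : A := (t%:C)%C *: 1.

Definition ii : A := ('i)%C *: 1.

Lemma sc0 : sc 0 = 0.
Proof. by rewrite /sc scale0r. Qed.

Lemma sc1 : sc 1 = 1.
Proof. by rewrite /sc scale1r. Qed.

Lemma scD s t : sc (s + t) = sc s + sc t.
Proof. by rewrite /sc rmorphD scalerDl. Qed.

Lemma scN t : sc (- t) = - sc t.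
Proof. by rewrite /sc rmorphN scaleNr. Qed.

Lemma scB s t : sc (s - t) = sc s - sc t.
Proof. by rewrite scD scN. Qed.

Lemma scM s t : sc (s * t) = sc s * sc t.
Proof. by rewrite /sc rmorphM -scalerAl mul1r scalerA. Qed.

Lemma scE t x : (t%:C)%C *: x = sc t * x.
Proof. by rewrite -scalerAl mul1r. Qed.

Lemma iiE x : ('i)%C *: x = ii * x.
Proof. by rewrite -scalerAl mul1r. Qed.

Lemma scC t x : sc t * x = x * sc t.
Proof. by rewrite -scalerAl mul1r -scalerAr mulr1. Qed.

Lemma iiC x : ii * x = x * ii.
Proof. by rewrite -scalerAl mul1r -scalerAr mulr1. Qed.

Lemma ii2 : ii * ii = -1.
Proof.
rewrite /ii -scalerAl mul1r scalerA -[in RHS]scaleN1r; congr (_ *: _).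
by rewrite -expr2 sqr_i.
Qed.

Lemma sc_half : sc 2^-1 + sc 2^-1 = 1.
Proof. by rewrite -scD -[RHS]sc1; congr sc; field. Qed.

Lemma star0 : star 0 = 0 :> A.
Proof. by apply: (addrI (star 0)); rewrite -starD !addr0. Qed.

Lemma starN x : star (- x) = - star x.
Proof. by rewrite -scaleN1r starZ rmorphN rmorph1 scaleN1r. Qed.

Lemma starB x y : star (x - y) = star x - star y.
Proof. by rewrite starD starN. Qed.

Lemma star1 : star 1 = 1 :> A.
Proof. by rewrite -[LHS]mul1r -{1}(starK 1) -starM mul1r starK. Qed.

Lemma star_sc t : star (sc t) = sc t.
Proof. by rewrite /sc starZ star1 conjc_real. Qed.

Lemma star_ii : star ii = - ii.
Proof.
rewrite /ii starZ star1 -scaleNr; congr (_ *: _).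
by apply/eqP; rewrite eq_complex /= oppr0 !eqxx.
Qed.

Lemma starX x n : star (x ^+ n) = star x ^+ n.
Proof. by elim: n => [|n IH]; rewrite ?star1 // exprS exprSr starM IH. Qed.

Lemma star_sum (I : Type) (r : seq I) (P : pred I) (F : I -> A) :
  star (\sum_(i <- r | P i) F i) = \sum_(i <- r | P i) star (F i).
Proof. exact: (big_morph _ starD star0). Qed.

Lemma star_unit x : x \is a GRing.unit -> star x \is a GRing.unit.
Proof.
move=> ux; apply/unitrP; exists (star x^-1).
by rewrite -!starM mulVr // mulrV // star1.
Qed.

Lemma starV x : x \is a GRing.unit -> star x^-1 = (star x)^-1.
Proof.
move=> ux; apply: (mulrI (star_unit ux)).
by rewrite -starM mulVr // star1 mulrV // star_unit.
Qed.

Lemma starVK x : x \is a GRing.unit -> star x * star x^-1 = 1.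
Proof. by move=> ux; rewrite -starM mulVr ?star1. Qed.

Lemma starKV x : x \is a GRing.unit -> star x^-1 * star x = 1.
Proof. by move=> ux; rewrite -starM mulrV ?star1. Qed.

Lemma nrm0 : nrm (0 : A) = 0.
Proof. by rewrite -(scale0r (0 : A)) nrmZ Normc.normc0 mul0r. Qed.

Lemma nrmN x : nrm (- x) = nrm x.
Proof.
by rewrite -scaleN1r nrmZ normcN Normc.normc1 mul1r.
Qed.

Lemma nrmB x y : nrm (x - y) <= nrm x + nrm y.
Proof. by rewrite -(nrmN y) nrmD. Qed.

Lemma nrm_distC x y : nrm (x - y) = nrm (y - x).
Proof. by rewrite -nrmN opprB. Qed.

Lemma nrm_ge0 x : 0 <= nrm x.
Proof.
by have := nrmB x x; rewrite subrr nrm0; lra.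
Qed.

Lemma nrm_triangle y x z : nrm (x - z) <= nrm (x - y) + nrm (y - z).
Proof. by rewrite (le_trans _ (nrmD _ _)) // addrA subrK. Qed.

Lemma nrm1 : nrm (1 : A) = 1.
Proof.
have := nrm_starM (1 : A); rewrite star1 mulr1 expr2.
move=> n2; have [/nrm0_eq0 /eqP|n0] := eqVneq (nrm (1 : A)) 0.
  by rewrite oner_eq0.
by apply: (mulfI n0); rewrite -n2 mulr1.
Qed.

Lemma nrm_star x : nrm (star x) = nrm x.
Proof.
have le y : nrm y <= nrm (star y).
  have [->|y0] := eqVneq (nrm y) 0; first exact: nrm_ge0.
  have := nrmM (star y) y; rewrite nrm_starM expr2.
  by rewrite ler_pM2r // lt0r y0 nrm_ge0.
by apply/eqP; rewrite eq_le le -{2}(starK x) le.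
Qed.

Lemma nrm_sc t : nrm (sc t) = `|t|.
Proof. by rewrite nrmZ nrm1 mulr1 /= expr0n /= addr0 sqrtr_sqr. Qed.

Lemma nrm_scM t x : nrm (sc t * x) = `|t| * nrm x.
Proof. by rewrite -scE nrmZ /= expr0n /= addr0 sqrtr_sqr. Qed.

Lemma nrm_iiM x : nrm (ii * x) = nrm x.
Proof. by rewrite -iiE nrmZ /= expr0n /= add0r expr1n sqrtr1 mul1r. Qed.

Lemma nrmX x n : nrm (x ^+ n) <= nrm x ^+ n.
Proof.
elim: n => [|n IH]; first by rewrite !expr0 nrm1.
rewrite !exprS (le_trans (nrmM _ _)) // ler_wpM2l ?nrm_ge0 //.
Qed.

Lemma nrm_sum (I : Type) (r : seq I) (P : pred I) (F : I -> A) :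
  nrm (\sum_(i <- r | P i) F i) <= \sum_(i <- r | P i) nrm (F i).
Proof.
elim/big_rec2: _ => [|i s t _ le]; first by rewrite nrm0.
by rewrite (le_trans (nrmD _ _)) // lerD2l.
Qed.

Lemma nrm_starMr x : nrm (x * star x) = nrm x ^+ 2.
Proof. by rewrite -(nrm_star x) -nrm_starM starK. Qed.

Lemma nrm_sa_sqr x : star x = x -> nrm (x * x) = nrm x ^+ 2.
Proof. by move=> sx; rewrite -{1}sx nrm_starM. Qed.

Lemma starM_eq0 x : star x * x = 0 -> x = 0.
Proof.
move=> /(congr1 (@nrm _ _)); rewrite nrm_starM nrm0 => /eqP.
by rewrite expf_eq0 /= => /eqP /nrm0_eq0.
Qed.

Lemma sc_unit t : t != 0 -> sc t \is a GRing.unit.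
Proof.
move=> t0; apply/unitrP; exists (sc t^-1).
by rewrite -!scM mulVf // mulfV // sc1.
Qed.

Lemma nrmV_gt0 x : x \is a GRing.unit -> 0 < nrm x^-1.
Proof.
move=> ux; rewrite lt0r nrm_ge0 andbT; apply/eqP => /nrm0_eq0 e.
by have := mulVr ux; rewrite e mul0r => /eqP; rewrite eq_sym oner_eq0.
Qed.

(** * Norm limits *)

Definition nlim (u : nat -> A) (l : A) : Prop :=
  (fun n => nrm (u n - l)) @ \oo --> (0 : R).

Lemma nlim_dominated (u : nat -> A) l (e : nat -> R) :
  (forall n, nrm (u n - l) <= e n) -> e @ \oo --> (0 : R) -> nlim u l.
Proof.
move=> ue e0; apply: (squeeze_cvgr _ (cvg_cst 0) e0).
by near=> n; rewrite nrm_ge0 /=.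
Unshelve. all: by end_near. Qed.

Lemma nlim_cst l : nlim (fun=> l) l.
Proof. by rewrite /nlim subrr nrm0; exact: cvg_cst. Qed.

Lemma nlimD u v l m : nlim u l -> nlim v m -> nlim (fun n => u n + v n) (l + m).
Proof.
move=> ul vm.
apply: (@nlim_dominated _ _ (fun n => nrm (u n - l) + nrm (v n - m))).
  by move=> n; rewrite opprD addrACA nrmD.
by rewrite -(addr0 0); exact: cvgD.
Qed.

Lemma nlimN u l : nlim u l -> nlim (fun n => - u n) (- l).
Proof.
move=> ul; apply: (@nlim_dominated _ _ (fun n => nrm (u n - l))) => // n.
by rewrite -opprD nrmN.
Qed.

Lemma nlimB u v l m : nlim u l -> nlim v m -> nlim (fun n => u n - v n) (l - m).
Proof. by move=> ul vm; apply: nlimD => //; exact: nlimN. Qed.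

Lemma nlimM u v l m : nlim u l -> nlim v m -> nlim (fun n => u n * v n) (l * m).
Proof.
move=> ul vm.
apply: (@nlim_dominated _ _ (fun n => nrm (u n - l) * nrm (v n - m)
   + (nrm (u n - l) * nrm m + nrm l * nrm (v n - m)))).
  move=> n.
  have -> : u n * v n - l * m
      = (u n - l) * (v n - m) + ((u n - l) * m + l * (v n - m)) by nc_ring.
  rewrite (le_trans (nrmD _ _)) // lerD ?nrmM //.
  by rewrite (le_trans (nrmD _ _)) // lerD ?nrmM.
have -> : (0 : R) = 0 * 0 + (0 * nrm m + nrm l * 0) by rewrite !(mulr0,mul0r,addr0).
apply: cvgD; first exact: cvgM.
by apply: cvgD; apply: cvgM => //; exact: cvg_cst.
Qed.

Lemma nlim_star u l : nlim u l -> nlim (fun n => star (u n)) (star l).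
Proof.
move=> ul; apply: (@nlim_dominated _ _ (fun n => nrm (u n - l))) => // n.
by rewrite -starB nrm_star.
Qed.

Lemma nlim_shift u l : nlim u l -> nlim (fun n => u n.+1) l.
Proof. by rewrite /nlim (cvg_shiftS (fun n => nrm (u n - l))). Qed.

Lemma nlim_unique u l m : nlim u l -> nlim u m -> l = m.
Proof.
move=> ul um; apply/subr0_eq/nrm0_eq0/eqP; rewrite eq_le nrm_ge0 andbT.
have c : (fun n => nrm (u n - l) + nrm (u n - m)) @ \oo --> (0 : R).
  by rewrite -(addr0 0); exact: cvgD.
rewrite -(cvg_lim _ c) //; apply: limr_ge; first by apply/cvg_ex; exists 0.
near=> n => /=; rewrite (nrm_distC (u n) l); exact: nrm_triangle.
Unshelve. all: by end_near. Qed.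

Lemma nlim_le u l t : (forall n, nrm (u n) <= t) -> nlim u l -> nrm l <= t.
Proof.
move=> ut ul.
have c : (fun n => nrm (u n - l) + t) @ \oo --> 0 + t.
  by apply: cvgD => //; exact: cvg_cst.
rewrite -(add0r t) -(cvg_lim _ c) //.
apply: limr_ge; first by apply/cvg_ex; exists (0 + t).
near=> n => /=; have := nrm_triangle (u n) l 0.
rewrite !subr0 nrm_distC => h; rewrite (le_trans h) // lerD2l //.
Unshelve. all: by end_near. Qed.

(** Comparison with a bounded monotone real sequence gives both the convergence
    and a bound on the tail. *)
Lemma nrm_dominated_cvg (u : nat -> A) (t : nat -> R) (T : R) :
  (forall n, nrm (u n.+1 - u n) <= t n.+1 - t n) -> (forall n, t n <= T) ->
  exists2 l, nlim u l & forall n, nrm (u n - l) <= T - t n.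
Proof.
move=> ut tT.
have ut' m d : nrm (u (m + d)%N - u m) <= t (m + d)%N - t m.
  elim: d => [|d IH]; first by rewrite addn0 !subrr nrm0.
  rewrite addnS (le_trans (nrm_triangle (u (m + d)%N) _ _)) //.
  by have := ut (m + d)%N; lra.
have tnd : nondecreasing_seq t.
  by apply/nondecreasing_seqP => n; have := ut n; have := nrm_ge0 (u n.+1 - u n); lra.
have ct : cvg (t @ \oo).
  apply: nondecreasing_is_cvgn => //.
  by exists T => _ [n _ <-].
have tL n : t n <= lim (t @ \oo) by exact: nondecreasing_cvgn_le.
have [l ul] : exists l, nlim u l.
  apply: nrm_complete => e e0.
  have /cvgrPdist_lt /(_ e e0) [N _ HN] : t @ \oo --> lim (t @ \oo) by [].
  exists N => m n.
  wlog nm : m n / (n <= m)%N => [th Nm Nn|Nm Nn].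
    by have [/th|/ltnW /th] := leqP n m; [exact|rewrite nrm_distC; exact].
  rewrite -(subnKC nm) (le_lt_trans (ut' _ _)) // subnKC //.
  have := HN n Nn; rewrite /= ger0_norm ?subr_ge0 //.
  by have := tL m; lra.
exists l => // n.
have := @nlim_le (fun d => u n - u (n + d)%N) (u n - l) (T - t n).
apply; first by move=> d; rewrite nrm_distC (le_trans (ut' _ _)) // lerD2r.
apply: nlimB; first exact: nlim_cst.
have := ul; rewrite /nlim -(cvg_shiftn n (fun k => nrm (u k - l))).
by under [X in _ -> cvg_to (fmap X _) _]eq_fun do rewrite addnC.
Qed.

(** * Neumann series *)

Lemma geometric_le (q : R) n : 0 <= q -> q < 1 ->
  \sum_(i < n) q ^+ i <= (1 - q)^-1.
Proof.
move=> q0 q1; have q1' : 0 < 1 - q by rewrite subr_gt0.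
rewrite -(ler_pM2l q1') mulfV ?gt_eqF //.
have := subrX1 q n; have := exprn_ge0 n q0; lra.
Qed.

Lemma neumann x : nrm x < 1 -> 1 - x \is a GRing.unit.
Proof.
move=> x1; have x0 := nrm_ge0 x.
have [|//|l ul _] := @nrm_dominated_cvg (fun n => \sum_(i < n) x ^+ i)
    (fun n => \sum_(i < n) nrm x ^+ i) (1 - nrm x)^-1.
- by move=> n; rewrite !big_ord_recr /= !(addrAC _ _ (- _)) !subrr !add0r nrmX.
- by move=> n; exact: geometric_le.
have x_n : nlim (fun n => 1 - x ^+ n) 1.
  apply: (@nlim_dominated _ _ (fun n => nrm x ^+ n)); last first.
    by apply: cvg_expr; rewrite ger0_norm.
  by move=> n; rewrite addrAC subrr add0r nrmN nrmX.
have c1 := nlim_cst (1 - x).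
apply/unitrP; exists l; split.
  apply: (nlim_unique (nlimM ul c1)); congr nlim: x_n.
  apply/funext => n; rewrite -[1 - x ^+ n]opprB subrX1.
  rewrite -mulNr opprB mulr_suml mulr_sumr; apply: eq_bigr => i _.
  by rewrite mulrBl mulrBr mul1r mulr1 -exprS -exprSr.
apply: (nlim_unique (nlimM c1 ul)); congr nlim: x_n.
by apply/funext => n; rewrite -[1 - x ^+ n]opprB subrX1 -mulNr opprB.
Qed.

Lemma neumann_sc t x : nrm x < t -> sc t - x \is a GRing.unit.
Proof.
move=> xt; have t0 : 0 < t := le_lt_trans (nrm_ge0 x) xt.
have -> : sc t - x = sc t * (1 - sc t^-1 * x).
  by rewrite mulrBr mulr1 mulrA -scM mulfV ?gt_eqF // sc1 mul1r.
rewrite unitrM_comm ?sc_unit ?gt_eqF //=; last exact: scC.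
by apply: neumann; rewrite nrm_scM gtr0_norm ?invr_gt0 // mulrC ltr_pdivrMr ?mul1r.
Qed.

End CStarBasics.
Arguments sc {R A}.
Arguments ii {R A}.

(** * Positive elements *)

Section Positivity.
Variables (R : realType) (A : cstarAlgType R).
Implicit Types (a x y z : A) (s t : R).

(** The criterion is stable under sums by the triangle inequality, and under
    limits because [t] can be chosen uniformly. *)
Definition npos a : Prop :=
  star a = a /\ exists2 t, 0 < t & nrm (sc t - a) <= t.

Lemma nrm_double x : nrm (x + x) = 2 * nrm x.
Proof.
have -> : x + x = sc 2 * x by rewrite (_ : 2 = 1 + 1) // scD sc1 mulrDl mul1r.
by rewrite nrm_scM ger0_norm.
Qed.

Lemma double_eq0 x : x + x = 0 -> x = 0.
Proof.
move=> h; apply: nrm0_eq0.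
have := nrm_double x; rewrite h nrm0; lra.
Qed.

(** With [z = 1 - a], the element [1 - l] is a square root of [a] iff
    [l = (z + l ^+ 2) / 2]. Iterating this equation from [0] converges because the
    increments are dominated by those of the real iteration with [1] for [z],
    which increases and stays at most [1]. *)
Lemma sqrt_near1 a : star a = a -> nrm (1 - a) <= 1 ->
  exists y, [/\ star y = y, nrm (1 - y) <= 1, y * y = a
    & forall z, z * a = a * z -> z * y = y * z].
Proof.
move=> sa a1; set z := 1 - a.
have sz : star z = z by rewrite /z starB star1 sa.
pose u := fix u n := if n is m.+1 then sc 2^-1 * (z + u m * u m) else 0 : A.
pose t := fix t n := if n is m.+1 then 2^-1 * (1 + t m * t m) else 0 : R.
have uS n : u n.+1 = sc 2^-1 * (z + u n * u n) by [].
have tS n : t n.+1 = 2^-1 * (1 + t n * t n) by [].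
have su n : star (u n) = u n.
  elim: n => [|n IH] /=; first exact: star0.
  by rewrite starM star_sc starD starM !IH sz scC.
have cu n x : x * z = z * x -> x * u n = u n * x.
  move=> xz; elim: n => [|n IH] /=; first by rewrite mulr0 mul0r.
  rewrite mulrA -scC -!mulrA; congr (_ * _).
  by rewrite mulrDr mulrDl xz mulrA IH -mulrA IH mulrA.
have cuu m n : u m * u n = u n * u m by apply: (cu n); rewrite (cu m z).
have t01 n : 0 <= t n <= 1.
  by elim: n => [|n IH] /=; [rewrite lexx ler01|nra].
have ut n : nrm (u n) <= t n.
  elim: n => [|n IH] /=; first by rewrite nrm0.
  rewrite nrm_scM ger0_norm ?invr_ge0 // ler_pM2l ?invr_gt0 //.
  rewrite (le_trans (nrmD _ _)) // lerD // (le_trans (nrmM _ _)) //.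
  by rewrite ler_pM ?nrm_ge0.
have [|n|l ul l1] := @nrm_dominated_cvg R A u t 1.
- elim=> [|n IH].
    rewrite /= !mulr0 !addr0 !subr0 mulr1 nrm_scM ger0_norm ?invr_ge0 //.
    by rewrite -[leRHS]mulr1 ler_pM2l ?invr_gt0.
  have -> : u n.+2 - u n.+1 = sc 2^-1 * ((u n.+1 - u n) * (u n.+1 + u n)).
    rewrite (uS n.+1) [X in _ - X]uS -mulrBr; congr (_ * _).
    have -> : (u n.+1 - u n) * (u n.+1 + u n)
       = u n.+1 * u n.+1 - u n * u n + (u n.+1 * u n - u n * u n.+1).
      by move: (u n.+1) (u n) => p q; nc_ring.
    by rewrite [u n.+1 * u n]cuu subrr addr0 opprD addrACA subrr add0r.
  have -> : t n.+2 - t n.+1 = 2^-1 * ((t n.+1 - t n) * (t n.+1 + t n)).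
    by rewrite (tS n.+1) [X in _ - X]tS; move: (t n.+1) (t n) => p q; ring.
  rewrite nrm_scM ger0_norm ?invr_ge0 // ler_pM2l ?invr_gt0 //.
  rewrite (le_trans (nrmM _ _)) // ler_pM ?nrm_ge0 //.
  by rewrite (le_trans (nrmD _ _)) // lerD.
- by case/andP: (t01 n).
have lE : l = sc 2^-1 * (z + l * l).
  apply: (nlim_unique (nlim_shift ul)) => /=.
  by apply: nlimM; [exact: nlim_cst|apply: nlimD; [exact: nlim_cst|exact: nlimM]].
have l2 : l + l = z + l * l.
  by rewrite {1 2}lE -mulrDl sc_half mul1r.
exists (1 - l); split.
- rewrite starB star1; congr (_ - _).
  have := nlim_star ul; under eq_fun do rewrite su.
  by move=> ul'; exact: nlim_unique ul' ul.
- rewrite opprB addrC subrK.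
  by have := l1 0; rewrite /= sub0r nrmN subr0.
- have -> : (1 - l) * (1 - l) = 1 + l * l - (l + l) by nc_ring.
  by rewrite l2 /z; nc_ring.
- move=> x xa; rewrite mulrBr mulrBl mulr1 mul1r; congr (_ - _).
  have xz : x * z = z * x by rewrite /z mulrBr mulrBl xa mulr1 mul1r.
  have c1 := nlimM (nlim_cst x) ul.
  apply: (nlim_unique c1); under eq_fun do rewrite (cu _ _ xz).
  by apply: nlimM => //; exact: nlim_cst.
Qed.

Lemma npos_sqrt a : npos a ->
  exists y, [/\ star y = y, npos y, y * y = a
    & forall z, z * a = a * z -> z * y = y * z].
Proof.
move=> [sa [t t0 at_]]; have t_neq0 : t != 0 by rewrite gt_eqF.
have [||y [sy y1 yy yc]] := @sqrt_near1 (sc t^-1 * a).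
- by rewrite starM star_sc sa scC.
- have -> : 1 - sc t^-1 * a = sc t^-1 * (sc t - a).
    by rewrite mulrBr -scM mulVf // sc1.
  by rewrite nrm_scM gtr0_norm ?invr_gt0 // mulrC ler_pdivrMr ?mul1r.
set r := Num.sqrt t; have r0 : 0 < r by rewrite sqrtr_gt0.
have sry : star (sc r * y) = sc r * y by rewrite starM star_sc sy scC.
exists (sc r * y); split => //.
- split => //; exists r => //.
  rewrite -{1}[sc r]mulr1 -mulrBr nrm_scM gtr0_norm //.
  by rewrite -[leRHS]mulr1 ler_pM2l.
- rewrite mulrA -[sc r * y * sc r]scC mulrA -scM -mulrA yy mulrA -scM.
  by rewrite -expr2 sqr_sqrtr ?ltW // mulfV // sc1 mul1r.
- move=> z za; rewrite mulrA -scC -!mulrA yc //.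
  by rewrite mulrA -scC -!mulrA za.
Qed.

(** [x + i sqrt (1 - x^2)] is unitary, so its imaginary part is a
    contraction. *)
Lemma nrm_1Bsqr x : star x = x -> nrm x <= 1 -> nrm (1 - x * x) <= 1.
Proof.
move=> sx x1; have sxx : star (1 - x * x) = 1 - x * x.
  by rewrite starB star1 starM sx.
have [//||y [sy _ yy yc]] := @sqrt_near1 (1 - x * x).
  rewrite opprB addrC subrK nrm_sa_sqr //.
  by rewrite expr_le1 ?nrm_ge0.
have xy : x * y = y * x by apply: yc; rewrite mulrBr mulrBl mulr1 mul1r mulrA.
set u := x + ii * y.
have su : star u = x - ii * y.
  by rewrite starD starM star_ii sx sy mulrN -iiC.
have uu : star u * u = 1.
  rewrite su.
  have -> : (x - ii * y) * u
      = x * x - (ii * y) * (ii * y) + (x * (ii * y) - ii * y * x).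
    by rewrite /u; nc_ring.
  have -> : ii * y * (ii * y) = - (y * y).
    by rewrite mulrA -(mulrA ii y) -iiC (mulrA ii ii) ii2 mulN1r mulNr.
  by rewrite -mulrA -xy mulrA -iiC -mulrA subrr addr0 opprK yy addrC subrK.
have nu : nrm u = 1.
  apply/eqP; have /eqP := nrm_starM u; rewrite uu nrm1 eq_sym sqrf_eq1.
  by case/orP => // /eqP; have := nrm_ge0 u; lra.
have y1 : nrm y <= 1.
  rewrite -nrm_iiM; have := nrm_double (ii * y).
  have -> : ii * y + ii * y = u - star u by rewrite su /u; nc_ring.
  have := nrmB u (star u); rewrite nrm_star nu; lra.
by rewrite -yy nrm_sa_sqr // expr_le1 ?nrm_ge0.
Qed.

Lemma sqr_ball x t : star x = x -> 0 < t -> nrm x ^+ 2 <= t ->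
  nrm (sc t - x * x) <= t.
Proof.
move=> sx t0 xt; set r := Num.sqrt t.
have r0 : 0 < r by rewrite sqrtr_gt0.
have rr : r * r = t by rewrite -expr2 sqr_sqrtr // ltW.
have rn : r != 0 by rewrite gt_eqF.
have h : nrm (1 - sc r^-1 * x * (sc r^-1 * x)) <= 1.
  apply: nrm_1Bsqr; first by rewrite starM star_sc sx scC.
  rewrite nrm_scM gtr0_norm ?invr_gt0 // mulrC ler_pdivrMr // mul1r.
  by rewrite -(@ler_pXn2r _ 2) ?nnegrE ?nrm_ge0 ?(ltW r0) // [leRHS]expr2 rr.
have -> : sc t - x * x = sc t * (1 - sc r^-1 * x * (sc r^-1 * x)).
  rewrite mulrBr mulr1 -rr scM; congr (_ - _).
  rewrite -(mulrA _ x) (mulrA x) -(scC _ x) !mulrA -!scM.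
  by rewrite -(mulrA r) mulfV // mulr1 mulfV // sc1 mul1r.
by rewrite nrm_scM gtr0_norm // -[leRHS]mulr1 ler_pM2l.
Qed.

Lemma npos_sqr x : star x = x -> npos (x * x).
Proof.
move=> sx; split; first by rewrite starM sx.
exists (nrm x ^+ 2 + 1); first by rewrite ltr_wpDl // exprn_ge0 ?nrm_ge0.
by apply: sqr_ball; rewrite ?ltr_wpDl ?exprn_ge0 ?nrm_ge0 // lerDl.
Qed.

Lemma npos_ball a t : npos a -> 0 < t -> nrm a <= t -> nrm (sc t - a) <= t.
Proof.
move=> /npos_sqrt [y [sy _ <- _]] t0 yt; apply: sqr_ball => //.
by rewrite -nrm_sa_sqr.
Qed.

Lemma nposD a x : npos a -> npos x -> npos (a + x).
Proof.
move=> [sa [t t0 ta]] [sx [s s0 sx_]]; split; first by rewrite starD sa sx.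
exists (t + s); first exact: addr_gt0.
by rewrite scD opprD addrACA (le_trans (nrmD _ _)) // lerD.
Qed.

Lemma npos_comm_mul a x : npos a -> npos x -> a * x = x * a -> npos (a * x).
Proof.
move=> /npos_sqrt [y [sy _ <- yc]] /npos_sqrt [z [sz _ <- zc]] c.
have yz : y * z = z * y by apply: zc; rewrite yc // c.
have -> : y * y * (z * z) = (y * z) * (y * z).
  by rewrite mulrA -(mulrA y y z) {1}yz !mulrA.
by apply: npos_sqr; rewrite starM sy sz yz.
Qed.

Lemma npos_subsc x t : star x = x -> nrm x <= t -> npos (sc t - x).
Proof.
move=> sx xt; split; first by rewrite starB star_sc sx.
exists (t + 1); first by rewrite ltr_wpDl // (le_trans (nrm_ge0 x)).
rewrite scD sc1 opprB addrC addrA subrK (le_trans (nrmD _ _)) // nrm1 lerD2r //.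
Qed.

Lemma npos_sc t : 0 <= t -> npos (sc t).
Proof.
by move=> t0; rewrite -[sc t]subr0; apply: npos_subsc; rewrite ?star0 ?nrm0.
Qed.

Lemma nposZ t a : 0 <= t -> npos a -> npos (sc t * a).
Proof.
by move=> t0 pa; apply: npos_comm_mul => //; [exact: npos_sc|exact: scC].
Qed.

Lemma npos_unit a s : npos a -> 0 < s -> sc s + a \is a GRing.unit.
Proof.
move=> [_ [t t0 ta]] s0.
have -> : sc s + a = sc (s + t) - (sc t - a) by rewrite scD; nc_ring.
by apply: neumann_sc; rewrite (le_lt_trans ta) // ltrDr.
Qed.

Lemma npos_closed a : (forall s, 0 < s -> npos (sc s + a)) -> npos a.
Proof.
move=> h; split.
  have [+ _] := h 1 ltr01; rewrite sc1 starD star1; exact: addrI.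
have t0 : 0 < nrm a + 1 by rewrite ltr_wpDl ?nrm_ge0.
exists (nrm a + 1) => //; apply/ler_addgt0Pr => e e0.
wlog e1 : e e0 / e <= 1.
  move=> th; have [/th|/ltW le] := leP e 1; first exact.
  by rewrite (le_trans (th 1 _ _)) // lerD2l.
have -> : sc (nrm a + 1) - a = sc (nrm a + 1) - (sc e + a) + sc e by nc_ring.
rewrite (le_trans (nrmD _ _)) // nrm_sc gtr0_norm // lerD2r.
apply: npos_ball => //; first exact: h.
rewrite (le_trans (nrmD _ _)) // nrm_sc gtr0_norm // addrC lerD2l //.
Qed.

Lemma unit_sqr y : y * y \is a GRing.unit -> y \is a GRing.unit.
Proof. by rewrite unitrM_comm // => /andP []. Qed.

Lemma saV y : star y = y -> y \is a GRing.unit -> star y^-1 = y^-1.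
Proof. by move=> sy uy; rewrite starV // sy. Qed.

(** [a - t^-1 = t^-1 * a * (t - a^-1)] is a product of commuting positive
    elements for [t = nrm a^-1]. *)
Lemma npos_bounded_below a : npos a -> a \is a GRing.unit ->
  exists2 d, 0 < d & npos (a - sc d).
Proof.
move=> pa ua; have [sa _] := pa.
have saV := saV sa ua.
set t := nrm a^-1; have t0 : 0 < t by exact: nrmV_gt0.
have [y [sy _ yy _]] := npos_sqrt pa.
have uy : y \is a GRing.unit by apply: unit_sqr; rewrite yy.
exists t^-1; first by rewrite invr_gt0.
have -> : a - sc t^-1 = sc t^-1 * (a * (sc t - a^-1)).
  by rewrite mulrBr mulrV // mulrBr mulr1 -(scC t a) mulrA -scM mulVf ?gt_eqF //
     sc1 mul1r.
apply: nposZ; first by rewrite invr_ge0 ltW.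
apply: npos_comm_mul => //; first exact: npos_subsc.
by rewrite mulrBr mulrBl mulrV // mulVr // scC.
Qed.

(** A self-adjoint element whose spectrum avoids the negative reals is
    positive: at the least [s] making [s + a] positive, [s + a] would otherwise
    be invertible, hence bounded below. *)
Lemma npos_spectrum a : star a = a ->
  (forall s, 0 < s -> sc s + a \is a GRing.unit) -> npos a.
Proof.
move=> sa ua; pose S := [set s : R | 0 <= s /\ npos (sc s + a)].
have S0 : has_inf S.
  split; last by exists 0 => s [].
  exists (nrm a); split; first exact: nrm_ge0.
  by rewrite -[a in X in npos X]opprK; apply: npos_subsc; rewrite ?starN ?sa ?nrmN.
set m := inf S.
have m0 : 0 <= m by apply: lb_le_inf; [case: S0|move=> s []].
have pm s : m < s -> npos (sc s + a).
  move=> ms; have [s' [s'0 ps'] s's] := inf_lt (proj1 S0) ms.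
  have -> : sc s + a = sc (s - s') + (sc s' + a) by rewrite scB; nc_ring.
  by apply: nposD => //; apply: npos_sc; rewrite subr_ge0 ltW.
have pma : npos (sc m + a).
  apply: npos_closed => s s0; rewrite addrA -scD; apply: pm.
  by rewrite ltrDr.
move: m0; rewrite le_eqVlt => /orP [/eqP m0|m0].
  by move: pma; rewrite -m0 sc0 add0r.
have [d d0 pd] := npos_bounded_below pma (ua _ m0).
pose d' := Num.min d m.
have d'0 : 0 < d' by rewrite lt_min d0 m0.
have : S (m - d').
  split; first by rewrite subr_ge0 ge_min lexx orbT.
  have -> : sc (m - d') + a = (sc m + a - sc d) + sc (d - d').
    by rewrite !scB; nc_ring.
  by apply: nposD => //; apply: npos_sc; rewrite subr_ge0 ge_min lexx.
move=> /(ge_inf (proj2 S0)); rewrite -/m; lra.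
Qed.

(** The parts are [(`|a| + a) / 2] and [(`|a| - a) / 2], with [`|a|] the positive
    square root [y] of [a * a]. They are positive by the spectral criterion:
    [(s + y + a) * (s + y - a) = s * (s + 2 * y)] is invertible for [s > 0]. *)
Lemma jordan_decomposition a : star a = a ->
  exists c d, [/\ npos c, npos d, a = c - d & c * d = 0].
Proof.
move=> sa; have [y [sy py yy yc]] := npos_sqrt (npos_sqr sa).
have ay : a * y = y * a by apply: yc; rewrite mulrA.
have P e : star e = e -> e * e = a * a -> e * y = y * e -> npos (y + e).
  move=> se ee ey; apply: npos_spectrum; first by rewrite starD sy se.
  move=> s s0.
  have c : (sc s + (y + e)) * (sc s + (y - e))
        = sc s * (sc s + (y + y)) + (e * sc s - sc s * e)
          + (e * y - y * e) + (y * y - e * e) + (y * sc s - sc s * y) by nc_ring.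
  have c' : (sc s + (y - e)) * (sc s + (y + e))
        = sc s * (sc s + (y + y)) + (sc s * e - e * sc s)
          + (y * e - e * y) + (y * y - e * e) + (y * sc s - sc s * y) by nc_ring.
  rewrite !(scC, ey, ee, yy, subrr, addr0) in c c'.
  have : (sc s + (y + e)) * (sc s + (y - e)) \is a GRing.unit.
    rewrite c -scC unitrM_comm ?scC //; last exact: scC.
    by rewrite sc_unit ?gt_eqF // npos_unit //; apply: nposD.
  by rewrite unitrM_comm => [/andP []//|]; rewrite /GRing.comm c c'.
have pp := P a sa erefl ay.
have pn : npos (y - a) by apply: P; rewrite ?starN ?sa ?mulrNN // mulrN mulNr ay.
have h0 : 0 <= 2^-1 :> R by rewrite invr_ge0.
exists (sc 2^-1 * (y + a)), (sc 2^-1 * (y - a)); split; try exact: nposZ.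
- rewrite -mulrBr opprB addrC addrA subrK.
  by rewrite -[LHS]mul1r -sc_half mulrDl mulrDr.
- rewrite mulrA -(mulrA _ _ (sc _)) -scC !mulrA -mulrA.
  have -> : (y + a) * (y - a) = (y * y - a * a) + (a * y - y * a) by nc_ring.
  by rewrite yy ay !subrr addr0 mulr0.
Qed.

Lemma unit_1D_swap x y : 1 + x * y \is a GRing.unit -> 1 + y * x \is a GRing.unit.
Proof.
move=> u; set v := (1 + x * y)^-1; apply/unitrP; exists (1 - y * v * x).
have e1 : v + x * y * v = 1 by rewrite -{1}(mul1r v) -mulrDl mulrV.
have e2 : v + v * x * y = 1 by rewrite -{1}(mulr1 v) -mulrA -mulrDr mulVr.
split.
  have -> : (1 - y * v * x) * (1 + y * x)
    = 1 + y * x - y * (v + v * x * y) * x by nc_ring.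
  by rewrite e2 mulr1 addrK.
have -> : (1 + y * x) * (1 - y * v * x)
    = 1 + y * x - y * (v + x * y * v) * x by nc_ring.
by rewrite e1 mulr1 addrK.
Qed.

(** If [x = d * d] and [- x = e * e] with commuting [d] and [e], then
    [v = d + i e] satisfies [star v * v = d * d + e * e = 0]. *)
Lemma npos_anti x : npos x -> npos (- x) -> x = 0.
Proof.
move=> /npos_sqrt [d [sd _ dd _]] /npos_sqrt [e [se _ ee ec]].
have de : d * e = e * d by apply: ec; rewrite -dd mulrN mulNr mulrA.
set v := d + ii * e.
have sv : star v = d - ii * e by rewrite starD starM star_ii sd se mulrN -iiC.
have : star v * v = 0.
  rewrite sv.
  have -> : (d - ii * e) * v
      = d * d - (ii * e) * (ii * e) + (d * (ii * e) - ii * e * d).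
    by rewrite /v; nc_ring.
  have -> : ii * e * (ii * e) = - (e * e).
    by rewrite mulrA -(mulrA ii e) -iiC (mulrA ii ii) ii2 mulN1r mulNr.
  rewrite -mulrA -de mulrA -iiC -mulrA subrr addr0 opprK ee dd subrr //.
move=> /starM_eq0 v0; rewrite -dd.
suff -> : d = 0 by rewrite mulr0.
apply: double_eq0.
have -> : d + d = v + star v by rewrite sv /v; nc_ring.
by rewrite v0 star0 addr0.
Qed.

(** The Fukamachi-Kaplansky theorem: with [d] the negative part of [star y * y],
    the element [z = y * d] has [star z * z = - d^3], while
    [star z * z + z * star z] is a sum of two squares of self-adjoint elements
    and [star z * z], [z * star z] have the same nonzero spectrum. *)
Lemma npos_starM y : npos (star y * y).
Proof.
have sa : star (star y * y) = star y * y by rewrite starM starK.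
have [c [d [pc pd acd cd]]] := jordan_decomposition sa.
have [sd _] := pd.
set z := y * d.
have zz : star z * z = - (d * d * d).
  rewrite /z starM sd mulrA -(mulrA d (star y) y) acd.
  have -> : d * (c - d) * d = d * (c * d) - d * d * d by nc_ring.
  by rewrite cd mulr0 sub0r.
have pddd : npos (d * d * d) by rewrite -mulrA; apply: npos_comm_mul => //;
  [exact: npos_sqr|rewrite mulrA].
have pz : npos (z * star z).
  set u := z + star z; set v := ii * (z - star z).
  have su : star u = u by rewrite starD starK addrC.
  have sv : star v = v.
    by rewrite starM star_ii starB starK mulrN -mulNr opprB -iiC.
  have vv : v * v = - ((z - star z) * (z - star z)).
    by rewrite mulrA -(mulrA ii _ ii) -iiC (mulrA ii ii) ii2 mulN1r mulNr.
  have e : z * star z = sc 2^-1 * (u * u + v * v) + d * d * d.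
    rewrite -[d * d * d]opprK -zz vv.
    have -> : u * u + - ((z - star z) * (z - star z))
      = (z * star z + star z * z) + (z * star z + star z * z).
      by rewrite /u; nc_ring.
    by rewrite mulrDr -mulrDl sc_half mul1r addrK.
  rewrite e; apply: nposD => //; apply: nposZ; first by rewrite invr_ge0.
  by apply: nposD; exact: npos_sqr.
have pz' : npos (star z * z).
  apply: npos_spectrum; first by rewrite starM starK.
  move=> s s0; have := npos_unit pz s0.
  have sn : s != 0 by rewrite gt_eqF.
  have E p q : sc s + p * q = sc s * (1 + (sc s^-1 * p) * q) :> A.
    by rewrite mulrDr mulr1 !mulrA -scM mulfV // sc1 mul1r.
  have U e : (sc s * e \is a GRing.unit) = (e \is a GRing.unit).
    by rewrite unitrM_comm ?sc_unit //; exact: scC.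
  by rewrite !E !U => /unit_1D_swap; rewrite mulrA -scC.
have z0 : star z * z = 0.
  by apply: npos_anti => //; rewrite zz opprK.
have d0 : d = 0.
  apply: starM_eq0; rewrite sd; apply: starM_eq0; rewrite starM sd.
  have /eqP : - (d * d * d) = 0 by rewrite -zz.
  by rewrite oppr_eq0 mulrA => /eqP ->; rewrite mul0r.
by rewrite acd d0 subr0.
Qed.

Lemma cposP a : cpos a <-> npos a.
Proof.
split; first by move=> [y ->]; exact: npos_starM.
by move=> /npos_sqrt [y [sy _ <- _]]; exists y; rewrite sy.
Qed.

End Positivity.

(** * Order and norm *)

Section Order.
Variables (R : realType) (A : cstarAlgType R).
Implicit Types (a x y z : A) (s t : R).

Lemma cpos_sa x : cpos x -> star x = x.
Proof. by move=> [y ->]; rewrite starM starK. Qed.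

Lemma cposD x y : cpos x -> cpos y -> cpos (x + y).
Proof. by move=> /cposP px /cposP py; apply/cposP/nposD. Qed.

Lemma cpos_sc t : 0 <= t -> cpos (sc t : A).
Proof. by move=> t0; apply/cposP/npos_sc. Qed.

Lemma cpos0 : cpos (0 : A).
Proof. by exists 0; rewrite mulr0. Qed.

Lemma cposZ t x : 0 <= t -> cpos x -> cpos (sc t * x).
Proof. by move=> t0 /cposP px; apply/cposP/nposZ. Qed.

Lemma cpos_sum (I : Type) (r : seq I) (P : pred I) (F : I -> A) :
  (forall i, P i -> cpos (F i)) -> cpos (\sum_(i <- r | P i) F i).
Proof. move=> pF; apply: big_ind => //; [exact: cpos0|exact: cposD]. Qed.

Lemma cpos_starM y : cpos (star y * y).
Proof. by exists y. Qed.

Lemma cpos_conj x y : cpos x -> cpos (star y * x * y).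
Proof. by move=> [z ->]; exists (z * y); rewrite starM !mulrA. Qed.

Lemma cle_refl x : cle x x.
Proof. by rewrite /cle subrr; exact: cpos0. Qed.

Lemma cle_trans y x z : cle x y -> cle y z -> cle x z.
Proof.
rewrite /cle => xy yz; have -> : z - x = (z - y) + (y - x) by nc_ring.
exact: cposD.
Qed.

Lemma cle_sc s t : s <= t -> cle (sc s : A) (sc t).
Proof. by move=> st; rewrite /cle -scB; apply: cpos_sc; rewrite subr_ge0. Qed.

Lemma cleD x y x' y' : cle x y -> cle x' y' -> cle (x + x') (y + y').
Proof. by rewrite /cle opprD addrACA; exact: cposD. Qed.

Lemma cle_conj x y z : cle x y -> cle (star z * x * z) (star z * y * z).
Proof. by rewrite /cle -mulrBl -mulrBr; exact: cpos_conj. Qed.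

Lemma cleZ t x y : 0 <= t -> cle x y -> cle (sc t * x) (sc t * y).
Proof. by rewrite /cle -mulrBr; exact: cposZ. Qed.

Lemma cle_cpos x y : cpos x -> cle x y -> cpos y.
Proof. by move=> px /(cposD px); rewrite addrC subrK. Qed.

Lemma cle_nrm x t : star x = x -> nrm x <= t -> cle x (sc t).
Proof. by move=> sx xt; apply/cposP/npos_subsc. Qed.

Lemma starM_cle y t : nrm y ^+ 2 <= t -> cle (star y * y) (sc t).
Proof. by move=> yt; apply: cle_nrm; rewrite ?nrm_starM // starM starK. Qed.

(** If [x = d * d] and [sc t - x = e * e] with [d], [e] commuting, then
    [d + i e] is a multiple of a unitary, and [d] is its real part. *)
Lemma nrm_cle x t : 0 <= t -> cpos x -> cle x (sc t) -> nrm x <= t.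
Proof.
move=> t0 /cposP /npos_sqrt [d [sd _ dd _]] /cposP /npos_sqrt [e [se _ ee ec]].
have de : d * e = e * d by apply: ec; rewrite -dd mulrBr mulrBl mulrA scC.
set v := d + ii * e.
have sv : star v = d - ii * e by rewrite starD starM star_ii sd se mulrN -iiC.
have vv : star v * v = sc t.
  rewrite sv.
  have -> : (d - ii * e) * v
      = d * d - (ii * e) * (ii * e) + (d * (ii * e) - ii * e * d).
    by rewrite /v; nc_ring.
  have -> : ii * e * (ii * e) = - (e * e).
    by rewrite mulrA -(mulrA ii e) -iiC (mulrA ii ii) ii2 mulN1r mulNr.
  by rewrite -mulrA -de mulrA -iiC -mulrA subrr addr0 opprK ee dd addrC subrK.
have dv : nrm d <= nrm v.
  have : nrm (d + d) <= nrm v + nrm (star v).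
    have -> : d + d = v + star v by rewrite sv /v; nc_ring.
    exact: nrmD.
  by rewrite nrm_double nrm_star; lra.
rewrite -dd nrm_sa_sqr //.
have := nrm_starM v; rewrite vv nrm_sc ger0_norm // => ->.
by rewrite ler_pXn2r ?nnegrE ?nrm_ge0.
Qed.

Lemma cpos_sqrt_unit x : cpos x -> x \is a GRing.unit ->
  exists k, [/\ star k = k, k * k = x & k \is a GRing.unit].
Proof.
move=> /cposP /npos_sqrt [k [sk _ kk _]] ux; exists k; split => //.
by apply: unit_sqr; rewrite kk.
Qed.

Lemma cpos_invr x : cpos x -> x \is a GRing.unit -> cpos x^-1.
Proof.
move=> px ux; have -> : x^-1 = star x^-1 * x * x^-1.
  by rewrite -mulrA mulrV // mulr1 saV ?cpos_sa.
exact: cpos_conj.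
Qed.

Lemma cle_sc_unit x t : 0 < t -> cle (sc t) x -> x \is a GRing.unit.
Proof.
move=> t0 /cposP px; have := npos_unit px t0; by rewrite addrC subrK.
Qed.

(** Conjugating [t <= x = k * k] by [k^-1] gives [t * x^-1 <= 1]. *)
Lemma cle_sc_invr x t : 0 < t -> cle (sc t) x -> nrm x^-1 <= t^-1.
Proof.
move=> t0 tx; have ux := cle_sc_unit t0 tx.
have px : cpos x by apply: cle_cpos tx; apply: cpos_sc; exact: ltW.
have [k [sk kk uk]] := cpos_sqrt_unit px ux.
have skV := saV sk uk.
apply: nrm_cle; [by rewrite invr_ge0 ltW|exact: cpos_invr|].
have := cle_conj k^-1 tx; rewrite skV -kk mulrA mulVr // mul1r mulrV //.
rewrite -scC -mulrA -invrM // kk => /(@cleZ t^-1).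
by rewrite mulrA -scM mulVf ?gt_eqF // sc1 mul1r mulr1 invr_ge0; apply; exact: ltW.
Qed.

Lemma cle_nrm_invr x : cpos x -> x \is a GRing.unit ->
  cle (sc (nrm x^-1)^-1) x.
Proof.
move=> px ux; have [k [sk kk uk]] := cpos_sqrt_unit px ux.
have t0 := nrmV_gt0 ux; set t := nrm x^-1 in t0 *.
have : cle x^-1 (sc t) by apply: cle_nrm => //; rewrite saV ?cpos_sa.
move=> /(cle_conj k); rewrite sk -{1}kk invrM // !mulrA mulrV // mul1r mulVr //.
rewrite -scC -mulrA kk => /(@cleZ t^-1).
by rewrite mulr1 mulrA -scM mulVf ?gt_eqF // sc1 mul1r invr_ge0; apply; exact: ltW.
Qed.

(** The Cauchy-Schwarz inequality of the Hilbert module [A^n], for the vectors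
    [sqrt (a k)] and [l k *: sqrt (a k)]. *)
Lemma nrm_unimodular_sum n (a : 'I_n -> A) (l : 'I_n -> R[i]) t : 0 < t ->
  (forall k, cpos (a k)) -> (forall k, conjc (l k) * l k = 1) ->
  cle (\sum_k a k) (sc t) -> nrm (\sum_k l k *: a k) <= t.
Proof.
move=> t0 pa l1; set p := \sum_k a k => pt; set c := \sum_k l k *: a k.
have sc_ : star c = \sum_k conjc (l k) *: a k.
  by rewrite star_sum; apply: eq_bigr => k _; rewrite starZ cpos_sa.
pose T k := star c * a k * c - sc t * (star c * (l k *: a k))
    - sc t * ((conjc (l k) *: a k) * c) + sc t * sc t * a k.
have pT k : cpos (T k).
  have [y ay] := pa k; pose e := l k *: y.
  have ye : star y * e = l k *: a k by rewrite -scalerAr -ay.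
  have ey : star e * y = conjc (l k) *: a k by rewrite starZ -scalerAl -ay.
  have ee : star e * e = a k.
    by rewrite starZ -scalerAl ye scalerA l1 scale1r.
  exists (y * c - sc t * e).
  rewrite starB !starM star_sc -scC /T -ye -ey -ee.
  have -> : (star c * star y - sc t * star e) * (y * c - sc t * e)
    = star c * (star y * y) * c - sc t * (star c * (star y * e))
      - sc t * (star e * y * c) + sc t * sc t * (star e * e)
      + (sc t * (star c * star y) - star c * star y * sc t) * e
      - sc t * (sc t * star e - star e * sc t) * e by nc_ring.
  rewrite (scC t (star c * star y)) (scC t (star e)) !subrr mulr0 !mul0r.
  by rewrite subr0 addr0 ee -ay.
have : cpos (star c * p * c - sc t * (star c * c) - sc t * (star c * c)
             + sc t * sc t * p).
  have -> : star c * p * c - sc t * (star c * c) - sc t * (star c * c)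
             + sc t * sc t * p = \sum_k T k; last first.
    by apply: cpos_sum => k _; exact: pT.
  rewrite /T !(big_split, sumrN) /=; congr (_ - _ - _ + _).
  - by rewrite -mulr_suml -mulr_sumr.
  - by rewrite -mulr_sumr -mulr_sumr.
  - by rewrite -mulr_sumr -mulr_suml -sc_.
  - by rewrite -mulr_sumr.
have := cpos_conj c pt.
have /(@cposZ (t * t)) := pt; rewrite mulr_ge0 ?(ltW t0) // => /(_ isT).
move=> h1 h2 h3; have := cposD (cposD h1 h2) h3.
have -> : sc (t * t) * (sc t - p) + star c * (sc t - p) * c
   + (star c * p * c - sc t * (star c * c) - sc t * (star c * c) + sc t * sc t * p)
   = sc (t * t) * sc t - sc t * (star c * c)
     + (star c * sc t - sc t * star c) * c
     + (sc t * sc t - sc (t * t)) * p by nc_ring.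
rewrite (scC t (star c)) subrr mul0r addr0 -!scM subrr mul0r addr0.
rewrite -mulrA scM -mulrBr => /(@cposZ t^-1).
rewrite invr_ge0 mulrA -scM mulVf ?gt_eqF // sc1 mul1r => /(_ (ltW t0)) h.
have := nrm_cle (mulr_ge0 (ltW t0) (ltW t0)) (cpos_starM c) h.
by rewrite nrm_starM -expr2 ler_pXn2r ?nnegrE ?nrm_ge0 ?(ltW t0).
Qed.

End Order.

(** * The Russo-Dye theorem *)

Section RootsOfUnity.
Variable R : realType.

(** The [n]-th iterated square root of [-1] has order [2 ^ n.+1]. *)
Lemma primitive_root_pow2 n : exists z : R[i],
  (2 ^ n.+1).-primitive_root z /\ conjc z * z = 1.
Proof.
pose z := iter n (@sqrtc R) (-1).
have zX : z ^+ (2 ^ n) = -1.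
  rewrite /z; elim: (n) => [|m IH] //=.
  by rewrite expnS exprM sqr_sqrtc.
have z1 : z ^+ (2 ^ n.+1) = 1 by rewrite expnSr exprM zX sqrrN expr1n.
exists z; split.
  have [|k pk] := prim_order_exists _ z1; first by rewrite expn_gt0.
  case/dvdn_pfactor => // m mn km; rewrite km in pk.
  move: mn; rewrite leq_eqVlt ltnS => /orP [/eqP <- //|mn].
  have : z ^+ (2 ^ n) == 1 by rewrite -(prim_order_dvd pk) dvdn_exp2l.
  by rewrite zX -subr_eq0 -opprD oppr_eq0 -(natrD _ 1 1) pnatr_eq0.
have nz : Normc.normc z = 1.
  have nX m : Normc.normc (z ^+ m) = Normc.normc z ^+ m.
    by elim: m => [|m IH]; rewrite ?Normc.normc1 // !exprS Normc.normcM IH.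
  apply/eqP; have := nX (2 ^ n.+1)%N; rewrite z1 Normc.normc1 => /esym/eqP.
  rewrite pexpr_eq1 ?expn_gt0 //.
  by case: (z) => a b; exact: sqrtr_ge0.
move: nz; case: (z) => a b /= /(congr1 (fun x => x ^+ 2)).
rewrite sqr_sqrtr ?addr_ge0 ?sqr_ge0 // expr1n => ab.
apply/eqP; rewrite eq_complex /=; apply/andP; split; apply/eqP.
  by rewrite -ab; ring.
by ring.
Qed.

Lemma sum_primitive_root N (z : R[i]) e :
  N.-primitive_root z -> (0 < e < N)%N -> \sum_(k < N) (z ^+ k) ^+ e = 0.
Proof.
move=> pz /andP [e0 eN].
have ze : z ^+ e - 1 != 0.
  rewrite subr_eq0 -(prim_order_dvd pz); apply/negP => /(dvdn_leq e0).
  by rewrite leqNgt eN.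
apply: (mulfI ze); rewrite mulr0.
under eq_bigr do rewrite -exprM mulnC exprM.
by rewrite -subrX1 -exprM mulnC exprM (prim_expr_order pz) expr1n subrr.
Qed.

End RootsOfUnity.

Section Fejer.
Variables (R : realType) (A : cstarAlgType R).
Implicit Types (x : A) (n : nat).

Definition geom x n : A := \sum_(i < n) x ^+ i.

(** The operator Fejer kernel: the sum of [(N - `|n|) x^(n)] over [`|n| < N],
    where [x^(n)] is [x ^+ n] or [star x ^+ `|n|]. *)
Definition fejer x N : A :=
  \sum_(n < N) (1 + x * geom x n + star (x * geom x n)).

(** The increment [1 + x g + star (x g)], with [g = geom x N] and hence
    [geom x N.+1 = 1 + x g], is
    [star (geom x N.+1) * geom x N.+1 - star g * star x * x * g]. *)
Lemma fejer_squares x N : fejer x N =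
  star (geom x N) * geom x N
    + \sum_(n < N) star (geom x n) * (1 - star x * x) * geom x n.
Proof.
elim: N => [|N IH]; first by rewrite /fejer /geom !big_ord0 mulr0 addr0.
rewrite /fejer !big_ord_recr /= -/(fejer x N) IH.
have -> : geom x N.+1 = 1 + x * geom x N.
  rewrite /geom big_ord_recl expr0; congr (_ + _).
  by rewrite mulr_sumr; apply: eq_bigr => i _; rewrite /= exprS.
move: (\sum_(n < N) _) (geom x N) => s g.
by rewrite starD star1 starM; nc_ring.
Qed.

Lemma fejer_cpos x N : nrm x <= 1 -> cpos (fejer x N).
Proof.
move=> x1; rewrite fejer_squares; apply: cposD; first exact: cpos_starM.
apply: cpos_sum => n _; apply: cpos_conj.
by rewrite -sc1; apply: starM_cle; rewrite expr_le1 ?nrm_ge0.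
Qed.

Lemma geomZ (c : R[i]) x n :
  (c *: x) * geom (c *: x) n = \sum_(i < n) c ^+ i.+1 *: x ^+ i.+1.
Proof.
rewrite /geom mulr_sumr; apply: eq_bigr => i _.
by rewrite -exprS exprZn.
Qed.

Variables (N M : nat) (z : R[i]).
Hypotheses (NM : (N.+2 < M)%N) (pz : M.-primitive_root z).
Hypothesis z1 : conjc z * z = 1.

Let l (k : 'I_M) : R[i] := z ^+ k.

Let conj_l k : conjc (l k) * l k = 1.
Proof. by rewrite /l rmorphXn -exprMn z1 expr1n. Qed.

Let sum_l e : (0 < e < M)%N -> \sum_k l k ^+ e = 0.
Proof. exact: sum_primitive_root. Qed.

Let sum_conj_l e : (0 < e < M)%N -> \sum_k conjc (l k) ^+ e = 0.
Proof.
move=> eM; rewrite -[RHS](rmorph0 (@conjc R)) -[in RHS](sum_l eM) rmorph_sum /=.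
by apply: eq_bigr => k _; rewrite [RHS]rmorphXn.
Qed.

Lemma fejer_mean x :
  \sum_k fejer (conjc (l k) *: x) N.+1 = ((M * N.+1)%:R : R[i]) *: 1.
Proof.
rewrite /fejer exchange_big /= (eq_bigr (fun=> (M%:R : R[i]) *: 1)) => [|n _].
  by rewrite sumr_const card_ord scalerMnl -mulr_natr -natrM.
have nM i : (i < n)%N -> (0 < i.+1 < M)%N by have := ltn_ord n; lia.
have E : \sum_k conjc (l k) *: x * geom (conjc (l k) *: x) n = 0.
  under eq_bigr do rewrite geomZ.
  rewrite exchange_big big1 //= => i _.
  by rewrite -scaler_suml sum_conj_l ?scale0r ?nM.
rewrite !big_split /= -star_sum E star0 !addr0 sumr_const card_ord.
by rewrite scaler_nat.
Qed.

Lemma fejer_moment x :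
  \sum_k l k *: fejer (conjc (l k) *: x) N.+1 = ((M * N)%:R : R[i]) *: x.
Proof.
have E n : (n < N.+1)%N ->
   \sum_k l k *: (1 + conjc (l k) *: x * geom (conjc (l k) *: x) n
     + star (conjc (l k) *: x * geom (conjc (l k) *: x) n))
   = (if n is 0 then 0 else M%:R) *: x.
  move=> nN; under eq_bigr do rewrite geomZ !scalerDr.
  rewrite !big_split /= -scaler_suml.
  rewrite (eq_bigr (fun k => l k ^+ 1)) // sum_l ?scale0r ?add0r; last by lia.
  have -> : \sum_k l k *: star (\sum_(i < n) conjc (l k) ^+ i.+1 *: x ^+ i.+1) = 0.
    rewrite (eq_bigr (fun k => \sum_(i < n) l k ^+ i.+2 *: star x ^+ i.+1)).
      rewrite exchange_big big1 //= => i _.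
      by rewrite -scaler_suml sum_l ?scale0r //; have := ltn_ord i; lia.
    move=> k _; rewrite star_sum scaler_sumr; apply: eq_bigr => i _.
    by rewrite starZ starX scalerA -rmorphXn /= conjcK -exprS.
  rewrite addr0; under eq_bigr do rewrite scaler_sumr.
  rewrite exchange_big /=.
  case: n nN => [|n] nN; first by rewrite big_ord0 scale0r.
  rewrite big_ord_recl /= [X in _ + X]big1 => [|i _]; last first.
    rewrite (eq_bigr (fun k => conjc (l k) ^+ i.+1 *: x ^+ i.+2)) => [|k _].
      by rewrite -scaler_suml sum_conj_l ?scale0r //; have := ltn_ord i; lia.
    by rewrite scalerA exprS mulrA [l k * _]mulrC conj_l mul1r.
  rewrite addr0 (eq_bigr (fun=> x)) => [|k _].
    by rewrite sumr_const card_ord scaler_nat.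
  by rewrite scalerA expr1 mulrC conj_l scale1r.
rewrite /fejer; under eq_bigr do rewrite scaler_sumr.
rewrite exchange_big /= (eq_bigr _ (fun (n : 'I_N.+1) _ => E n (ltn_ord n))).
rewrite big_ord_recl /= scale0r add0r sumr_const card_ord scalerMnl.
by rewrite -mulr_natr -natrM.
Qed.

End Fejer.

Section RussoDye.
Variables (R : realType) (A B : cstarAlgType R) (f : {linear A -> B}).
Hypothesis f_pos : positive_map f.

(** The values of [f] at the positive elements [fejer (conjc l *: x) N.+1], for
    [l] a root of unity, are positive and have mean [N.+1 * f 1]; weighted by the
    unimodular numbers [l] their mean is [N * f x]. So the Cauchy-Schwarz
    inequality gives [N * nrm (f x) <= N.+1 * t], and [N] is arbitrary. *)
Lemma russo_dye t x : 0 <= t -> cle (f 1) (sc t) -> nrm (f x) <= t * nrm x.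
Proof.
move=> t0 ft.
have main s y : 0 < s -> cle (f 1) (sc s) -> nrm y <= 1 -> nrm (f y) <= s.
  move=> s0 fs y1.
  have bound N : N%:R * nrm (f y) <= N.+1%:R * s.
    have [z [pz z1]] := primitive_root_pow2 R N.+2.
    have NM : (N.+2 < 2 ^ N.+3)%N by rewrite (ltn_trans (ltnSn _)) // ltn_expl.
    move: (2 ^ N.+3)%N NM pz => M NM pz.
    pose l (k : 'I_M) : R[i] := z ^+ k.
    have cl k : conjc (l k) * l k = 1 by rewrite /l rmorphXn -exprMn z1 expr1n.
    have nl k : Normc.normc (conjc (l k)) = 1.
      have := cl k; case: (l k) => a b /eqP; rewrite eq_complex /= => /andP [/eqP ab _].
      by rewrite sqrrN !expr2 -[RHS]sqrtr1; congr Num.sqrt; rewrite -ab; ring.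
    have M0 : 0 < M%:R :> R by rewrite ltr0n; lia.
    have MN0 : 0 < (M * N.+1)%:R * s by rewrite mulr_gt0 // ltr0n muln_gt0; lia.
    have natE m (v : B) : ((m%:R : R[i]) *: v) = sc m%:R * v.
      by rewrite -scE; congr (_ *: _); rewrite rmorph_nat.
    pose a k := f (fejer (conjc (l k) *: y) N.+1).
    have pa k : cpos (a k).
      by apply/f_pos/fejer_cpos; rewrite nrmZ nl mul1r.
    have sa : cle (\sum_k a k) (sc ((M * N.+1)%:R * s)).
      rewrite -linear_sum fejer_mean // linearZ /= natE scM.
      by apply: cleZ.
    have := nrm_unimodular_sum MN0 pa cl sa.
    have -> : \sum_k l k *: a k = sc (M * N)%:R * f y.
      rewrite -natE -linearZ /= -(fejer_moment NM pz z1) linear_sum.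
      by apply: eq_bigr => k _; rewrite linearZ.
    by rewrite nrm_scM ger0_norm // !natrM -!mulrA ler_pM2l.
  rewrite leNgt; apply/negP => sy.
  have d0 : 0 < nrm (f y) - s by rewrite subr_gt0.
  have [N HN] : exists N : nat, s / (nrm (f y) - s) < N%:R.
    exists (Num.truncn (s / (nrm (f y) - s))).+1; exact: truncnS_gt.
  have := bound N; rewrite -natr1 mulrDl mul1r.
  by move: HN; rewrite ltr_pdivrMr // mulrBr; lra.
have [x0|x0] := eqVneq (nrm x) 0.
  by rewrite (nrm0_eq0 _ x0) linear0 !nrm0 mulr0.
apply/ler_addgt0Pr => e e0.
have n0 : 0 < nrm x by rewrite lt0r x0 nrm_ge0.
pose s := t + e / nrm x.
have s0 : 0 < s by rewrite ltr_wpDl // divr_gt0.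
have : nrm (f (sc (nrm x)^-1 * x)) <= s.
  apply: main => //.
    by apply: cle_trans ft (cle_sc _ _); rewrite lerDl divr_ge0 // ltW.
  by rewrite nrm_scM gtr0_norm ?invr_gt0 // mulVf.
rewrite -scE linearZ /= scE nrm_scM gtr0_norm ?invr_gt0 //.
rewrite mulrC ler_pdivrMr // mulrDl divfK //.
Qed.

End RussoDye.

(** * Half-planes *)

Section HalfPlane.
Variables (R : realType) (A : cstarAlgType R).
Implicit Types (a c x y z w : A) (s t : R).

Definition cRe x : A := sc 2^-1 * (x + star x).

Lemma cImE x : cIm x = sc 2^-1 * (- ii * (x - star x)).
Proof.
have i2 : ('i%C : R[i]) * 'i%C = -1 by rewrite -expr2 sqr_i.
have i0 : ('i%C : R[i]) != 0.
  by apply/eqP => i0; move: i2; rewrite i0 mul0r => /esym/eqP;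
     rewrite oppr_eq0 oner_eq0.
have E : (2 * 'i%C : R[i])^-1 = (2^-1)%:C%C * - 'i%C.
  apply: (mulfI (mulf_neq0 _ i0 : 2 * 'i%C != 0)); first by rewrite pnatr_eq0.
  rewrite mulfV ?mulf_neq0 ?pnatr_eq0 // mulrACA mulrN i2 opprK mulr1.
  by rewrite fmorphV rmorph_nat mulfV // pnatr_eq0.
by rewrite /cIm E -scalerA scE scaleNr iiE mulNr.
Qed.

Lemma cRe_cIm x : x = cRe x + ii * cIm x.
Proof.
rewrite cImE mulrA iiC -mulrA -mulrDr mulrA mulrN ii2 opprK mul1r.
have -> : x + star x + (x - star x) = x + x by nc_ring.
by rewrite mulrDr -mulrDl sc_half mul1r.
Qed.

Lemma cRe_sa x : star (cRe x) = cRe x.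
Proof. by rewrite /cRe starM star_sc starD starK -scC addrC. Qed.

Lemma cIm_sa x : star (cIm x) = cIm x.
Proof.
rewrite cImE !(starM, starN) star_sc star_ii opprK starB starK -scC -iiC.
by rewrite -[star x - x]opprB mulrN mulNr.
Qed.

Lemma cImD x y : cIm (x + y) = cIm x + cIm y.
Proof. by rewrite /cIm starD -scalerDr opprD addrACA. Qed.

Lemma cImN x : cIm (- x) = - cIm x.
Proof. by rewrite /cIm starN -scalerN opprB opprK addrC. Qed.

Lemma cImB x y : cIm (x - y) = cIm x - cIm y.
Proof. by rewrite cImD cImN. Qed.

Lemma cImZ t x : cIm (sc t * x) = sc t * cIm x.
Proof. by rewrite /cIm starM star_sc -scC -mulrBr scalerAr. Qed.

Lemma cIm_real x : star x = x -> cIm x = 0.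
Proof. by move=> sx; rewrite /cIm sx subrr scaler0. Qed.

Lemma cIm_ii x : star x = x -> cIm (ii * x) = x.
Proof.
move=> sx; rewrite cImE starM sx star_ii mulrN -iiC opprK -mulrDr [- ii * _]mulrA.
by rewrite mulNr ii2 opprK mul1r mulrDr -mulrDl sc_half mul1r.
Qed.

Lemma cIm_conj x z : cIm (star z * x * z) = star z * cIm x * z.
Proof.
by rewrite /cIm !starM starK mulrA -mulrBl -mulrBr -scalerAr -scalerAl.
Qed.

Lemma nrm_cIm x : nrm (cIm x) <= nrm x.
Proof.
rewrite cImE nrm_scM mulNr nrmN nrm_iiM ger0_norm ?invr_ge0 //.
by have := nrmB x (star x); rewrite nrm_star; lra.
Qed.

Lemma cIm_invr c : c \is a GRing.unit ->
  - cIm c^-1 = star c^-1 * cIm c * c^-1.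
Proof.
move=> uc; rewrite -cIm_conj -mulrA mulrV // mulr1 /cIm starK -scalerN.
by rewrite opprB.
Qed.

Lemma cIm_invr_swap c : c \is a GRing.unit ->
  - cIm c^-1 = c^-1 * cIm c * star c^-1.
Proof.
move=> uc; have := cIm_conj c (star c^-1); rewrite starK => <-.
rewrite mulVr // mul1r /cIm starK -scalerN.
by rewrite opprB.
Qed.

(** With [k] the square root of [cIm c], the element [c] is
    [k * (x + i) * k] for a self-adjoint [x]. *)
Lemma cIm_gt0_unit c t : 0 < t -> cle (sc t) (cIm c) -> c \is a GRing.unit.
Proof.
move=> t0 tc; have uv := cle_sc_unit t0 tc.
have pv : cpos (cIm c) by apply: cle_cpos tc; apply: cpos_sc; exact: ltW.
have [k [sk kk uk]] := cpos_sqrt_unit pv uv.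
have skV := saV sk uk.
pose x := k^-1 * cRe c * k^-1.
have sx : star x = x by rewrite /x (starM (k^-1 * _)) (starM k^-1) skV cRe_sa mulrA.
have -> : c = k * (x + ii) * k.
  rewrite mulrDr mulrDl -(iiC k) -(mulrA ii) kk [LHS]cRe_cIm /x; congr (_ + _).
  by rewrite !mulrA mulrV // mul1r -mulrA mulVr // mulr1.
rewrite unitrMl // unitrMr //.
have c1 : (x + ii) * (x - ii) = sc 1 + x * x.
  have -> : (x + ii) * (x - ii) = x * x - ii * ii + (ii * x - x * ii) by nc_ring.
  by rewrite iiC subrr addr0 ii2 opprK addrC sc1.
have c2 : (x - ii) * (x + ii) = sc 1 + x * x.
  have -> : (x - ii) * (x + ii) = x * x - ii * ii - (ii * x - x * ii) by nc_ring.
  by rewrite iiC subrr subr0 ii2 opprK addrC sc1.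
have : (x + ii) * (x - ii) \is a GRing.unit.
  by rewrite c1; apply: npos_unit => //; exact: npos_sqr.
by rewrite unitrM_comm => [/andP []//|]; rewrite /GRing.comm c1 c2.
Qed.

Lemma nrm_mono x y : cpos x -> cle x y -> nrm x <= nrm y.
Proof.
move=> px xy; apply: nrm_cle => //; first exact: nrm_ge0.
apply: (cle_trans xy); apply: cle_nrm => //.
exact/cpos_sa/(cle_cpos px xy).
Qed.

(** With [z = c^-1], [t * nrm z ^+ 2 <= nrm (star z * cIm c * z)], and this
    element is [- cIm z], of norm at most [nrm z]. *)
Lemma nrm_invr_cIm c t : 0 < t -> cle (sc t) (cIm c) -> nrm c^-1 <= t^-1.
Proof.
move=> t0 tc; have uc := cIm_gt0_unit t0 tc; set z := c^-1.
have n0 : 0 < nrm z by exact: nrmV_gt0.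
have h : nrm (sc t * (star z * z)) <= nrm (- cIm z).
  apply: nrm_mono; first by apply: cposZ; [exact: ltW|exact: cpos_starM].
  by rewrite cIm_invr // mulrA scC; apply: cle_conj.
rewrite nrmN nrm_scM gtr0_norm // nrm_starM in h.
have := le_trans h (nrm_cIm z).
by rewrite expr2 mulrA -[leRHS]mul1r ler_pM2r // mulrC -ler_pdivlMr // div1r.
Qed.

(** [s * star c^-1 * c^-1 <= - cIm c^-1], and conjugating [star c * c <= N ^+ 2]
    by [c^-1] bounds [star c^-1 * c^-1] below. *)
Lemma cIm_invr_ge c s t N : 0 < t -> cle (sc t) (cIm c) -> 0 <= s ->
  cle (sc s) (cIm c) -> 0 < N -> nrm c <= N ->
  cle (sc (s * N ^- 2)) (- cIm c^-1).
Proof.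
move=> t0 tc s0 sc_ N0 cN; have uc := cIm_gt0_unit t0 tc.
rewrite cIm_invr //; apply: cle_trans (cle_conj _ sc_).
rewrite -scC -mulrA scM; apply: cleZ => //.
have := cle_conj c^-1 (@starM_cle R A c (N ^+ 2) _).
rewrite mulrA -starM mulrV // star1 mul1r mulrV // => h.
have {h} : cle 1 (sc (N ^+ 2) * (star c^-1 * c^-1)).
  rewrite mulrA scC; apply: h.
  by rewrite ler_pXn2r ?nnegrE ?nrm_ge0 ?(ltW N0).
move=> /(@cleZ _ _ (N ^- 2)); rewrite mulr1 mulrA -scM mulVf ?sc1 ?mul1r; last first.
  by rewrite expf_neq0 // gt_eqF.
by apply; rewrite invr_ge0 exprn_ge0 // ltW.
Qed.

End HalfPlane.

(** * Positive linear maps *)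

Section PositiveMap.
Variables (R : realType) (A B : cstarAlgType R) (f : {linear A -> B}).
Hypothesis f_pos : positive_map f.
Implicit Types (x y : A).

Lemma linear_scM t x : f (sc t * x) = sc t * f x.
Proof. by rewrite -!scE linearZ. Qed.

Lemma linear_iiM x : f (ii * x) = ii * f x.
Proof. by rewrite -!iiE linearZ. Qed.

Lemma positive_map_sa x : star x = x -> star (f x) = f x.
Proof.
move=> sx.
have -> : x = sc (nrm x) - (sc (nrm x) - x) by nc_ring.
rewrite linearB starB; congr (_ - _); apply/cpos_sa/f_pos.
  exact/cpos_sc/nrm_ge0.
exact: cle_nrm.
Qed.

Lemma positive_map_star x : f (star x) = star (f x).
Proof.
move: (cRe_cIm x) (cRe_sa x) (cIm_sa x); move: (cRe x) (cIm x) => u v -> su sv.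
rewrite starD starM star_ii su sv mulrN -iiC.
rewrite linearB linearD !linear_iiM starD starM star_ii.
by rewrite !positive_map_sa // mulrN -iiC.
Qed.

Lemma positive_map_cIm x : f (cIm x) = cIm (f x).
Proof. by rewrite /cIm linearZ linearB /= positive_map_star. Qed.

Lemma positive_map_bounded x : nrm (f x) <= nrm (f 1) * nrm x.
Proof.
apply: russo_dye => //; first exact: nrm_ge0.
by apply: cle_nrm => //; apply: positive_map_sa; rewrite star1.
Qed.

Lemma opnorm_has_sup : has_sup [set nrm (f x) | x in [set x | nrm x <= 1]].
Proof.
split; first by exists (nrm (f 0)), 0 => //=; rewrite nrm0.
exists (nrm (f 1)) => _ [x /= x1 <-].
rewrite (le_trans (positive_map_bounded x)) // -[leRHS]mulr1.
by rewrite ler_wpM2l ?nrm_ge0.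
Qed.

Lemma nrm_opnorm x : nrm (f x) <= opnorm f * nrm x.
Proof.
have [x0|x0] := eqVneq (nrm x) 0.
  by rewrite (nrm0_eq0 _ x0) linear0 !nrm0 mulr0.
have n0 : 0 < nrm x by rewrite lt0r x0 nrm_ge0.
rewrite -ler_pdivrMr // mulrC.
have -> : (nrm x)^-1 * nrm (f x) = nrm (f (sc (nrm x)^-1 * x)).
  by rewrite linear_scM nrm_scM gtr0_norm ?invr_gt0.
apply: (ub_le_sup (proj2 opnorm_has_sup)); exists (sc (nrm x)^-1 * x) => //=.
by rewrite nrm_scM gtr0_norm ?invr_gt0 // mulVf.
Qed.

Lemma opnorm_ge0 : 0 <= opnorm f.
Proof.
by rewrite (le_trans (nrm_ge0 (f 1))) // -[leRHS]mulr1 -(nrm1 A) nrm_opnorm.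
Qed.

End PositiveMap.

(** * Differential calculus *)

Section Derivative.
Variable R : realType.
Implicit Types (A B C : cstarAlgType R).

Definition deriv_at A B (f : A -> B) (x : A) (L : {linear A -> B}) : Prop :=
  (exists M : R, forall v : A, nrm (L v) <= M * nrm v) /\
  forall e : R, 0 < e -> exists2 d : R, 0 < d &
    forall v : A, nrm v < d -> nrm (f (x + v) - f x - L v) <= e * nrm v.

Lemma deriv_bound A B (f : A -> B) x L : deriv_at f x L ->
  exists2 M : R, 0 < M & forall v, nrm (L v) <= M * nrm v.
Proof.
move=> [[M LM] _]; exists (`|M| + 1); first by rewrite ltr_wpDl.
move=> v; rewrite (le_trans (LM v)) // ler_wpM2r ?nrm_ge0 //.
by rewrite (le_trans (ler_norm M)) // lerDl.
Qed.

Lemma deriv_comp A B C (f : A -> B) (g : B -> C) x L K :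
  deriv_at f x L -> deriv_at g (f x) K -> deriv_at (g \o f) x (K \o L).
Proof.
move=> df dg; have [M M0 LM] := deriv_bound df; have [N N0 KN] := deriv_bound dg.
case: df dg => _ df [_ dg]; split.
  exists (N * M) => v; rewrite (le_trans (KN _)) // -mulrA ler_pM2l //.
move=> e e0.
have e1 : 0 < e / (2 * N) by rewrite divr_gt0 // mulr_gt0.
have M1 : 0 < M + 1 by rewrite addr_gt0.
have e2 : 0 < e / (2 * (M + 1)) by rewrite divr_gt0 // mulr_gt0.
have [d1 d10 h1] := df _ e1; have [d3 d30 h3] := df 1 ltr01.
have [d2 d20 h2] := dg _ e2.
exists (Num.min (Num.min d1 d3) (d2 / (M + 1))).
  by rewrite !lt_min d10 d30 divr_gt0.
move=> v; rewrite !lt_min => /andP [/andP [v1 v3] v2].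
set u := f (x + v) - f x.
have uv : nrm u <= (M + 1) * nrm v.
  have -> : u = (u - L v) + L v by rewrite subrK.
  rewrite (le_trans (nrmD _ _)) // mulrDl addrC lerD //.
  exact: h3.
have ud : nrm u < d2.
  by rewrite (le_lt_trans uv) // mulrC -ltr_pdivlMr.
have -> : (g \o f) (x + v) - (g \o f) x - (K \o L) v
    = (g (f x + u) - g (f x) - K u) + K (u - L v).
  rewrite [K (u - _)]linearB /= /u [f x + _]addrC subrK.
  by nc_ring.
rewrite (le_trans (nrmD _ _)) //.
have -> : e * nrm v = e / (2 * (M + 1)) * ((M + 1) * nrm v)
    + N * (e / (2 * N) * nrm v) by field; rewrite !gt_eqF.
rewrite lerD // ?(le_trans (h2 _ ud)) ?ler_pM2l // (le_trans (KN _)) //.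
by rewrite ler_pM2l // h1.
Qed.

(** A function whose derivative along a segment is bounded by [C] cannot leave
    the cone of slope [C + e] at the first end of the segment: consider the
    supremum of the parameters at which it has not left it. *)
Lemma mean_value A B (f : A -> B) (w u : A) (C : R) :
  (forall s, 0 <= s <= 1 -> exists2 L, deriv_at f (w + sc s * u) L &
     nrm (L u) <= C) ->
  nrm (f (w + u) - f w) <= C.
Proof.
move=> df; apply/ler_addgt0Pr => e e0; pose p s := f (w + sc s * u).
have n0 : 0 < nrm u + 1 by rewrite ltr_wpDl ?nrm_ge0.
have loc s : 0 <= s <= 1 -> exists2 d, 0 < d & forall s',
    `|s' - s| < d -> nrm (p s' - p s) <= (C + e) * `|s' - s|.
  move=> /df [L [_ dL] Lu]; have [d d0 h] := dL _ (divr_gt0 e0 n0).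
  exists (d / (nrm u + 1)); first exact: divr_gt0.
  move=> s' ss'.
  have -> : p s' - p s = (p s' - p s - L (sc (s' - s) * u)) + L (sc (s' - s) * u).
    by rewrite subrK.
  rewrite mulrDl addrC (le_trans (nrmD _ _)) // lerD //.
    by rewrite linear_scM nrm_scM mulrC ler_wpM2r.
  have := h (sc (s' - s) * u); rewrite -(addrA w) -mulrDl -scD [s + _]addrC subrK.
  rewrite nrm_scM => /(_ _)/le_trans; apply.
    rewrite (le_lt_trans (ler_wpM2l (normr_ge0 _) (_ : _ <= nrm u + 1))) ?lerDl //.
    by rewrite -ltr_pdivlMr.
  rewrite mulrCA mulrC ler_wpM2r // -mulrA ler_piMr ?(ltW e0) //.
  by rewrite mulrC ler_pdivrMr // mul1r lerDl.
pose S := [set s : R | 0 <= s <= 1 /\ nrm (p s - p 0) <= (C + e) * s].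
have S0 : S 0 by rewrite /S /= lexx ler01 subrr nrm0 mulr0.
have hS : has_sup S by split; [exists 0|exists 1 => s [/andP []]].
set m := sup S.
have m01 : 0 <= m <= 1.
  apply/andP; split; first exact: (ub_le_sup (proj2 hS)).
  by apply: (ge_sup (proj1 hS)) => s [/andP []].
have step s s' : S s -> s <= s' <= 1 ->
    nrm (p s' - p s) <= (C + e) * (s' - s) -> S s'.
  move=> [/andP [s0 _] hs] /andP [ss' s'1] h; split.
    by rewrite s'1 (le_trans s0).
  rewrite (le_trans (nrm_triangle (p s) _ _)) //.
  by have -> : (C + e) * s' = (C + e) * (s' - s) + (C + e) * s;
    [ring|rewrite lerD].
have [d d0 hd] := loc m m01.
have le_m s : S s -> s <= m by exact: (ub_le_sup (proj2 hS)).
have Sm : S m.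
  have [s Ss ms] := sup_adherent d0 hS; rewrite -/m in ms.
  have sm := le_m _ Ss; have /andP [_ m1] := m01.
  apply: (step s) => //; first by rewrite sm.
  have := hd s; rewrite distrC ger0_norm ?subr_ge0 // nrm_distC; apply; lra.
have Smd : S (Num.min 1 (m + d / 2)).
  have /andP [m0 m1] := m01.
  have mm : m <= Num.min 1 (m + d / 2) by rewrite le_min m1 lerDl divr_ge0 // ltW.
  apply: (step m) => //; first by rewrite mm ge_min lexx.
  have := hd (Num.min 1 (m + d / 2)); rewrite ger0_norm ?subr_ge0 //; apply.
  have : Num.min 1 (m + d / 2) <= m + d / 2 by rewrite ge_min lexx orbT.
  lra.
have m1 : m = 1.
  apply/eqP; rewrite eq_le; case/andP: m01 => _ -> /=.
  rewrite leNgt; apply/negP => m1; have := le_m _ Smd.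
  by rewrite ge_min => /orP [|]; lra.
move: Sm => []; rewrite m1 mulr1 /p sc1 sc0 mul1r mul0r addr0 => _.
by [].
Qed.

End Derivative.

(** * The infinitesimal metric of the lower half-plane *)

Section Metric.
Variables (R : realType) (A : cstarAlgType R).
Implicit Types (a k v w x : A) (s t : R).

(** The bound [t] on the Caratheodory length [nrm (y^-1/2 * v * y^-1/2)] of the
    tangent vector [v] at [w], with [y = - cIm w]. Any factorisation
    [y = star a * a] may replace the square root of [y], which makes the
    transport by congruences immediate. *)
Definition infinitesimal_le w t v : Prop :=
  exists a x, [/\ a \is a GRing.unit, - cIm w = star a * a,
                  v = star a * x * a & nrm x <= t].

Lemma infinitesimal_le_nrm w t v : infinitesimal_le w t v -> nrm v <= nrm w * t.
Proof.
move=> [a [x [_ wa -> xt]]]; rewrite (le_trans (nrmM _ _)) //.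
rewrite (le_trans (ler_wpM2r (nrm_ge0 _) (nrmM _ _))) // nrm_star mulrAC -expr2.
apply: ler_pM => //; rewrite ?exprn_ge0 ?nrm_ge0 //.
by rewrite -nrm_starM -wa nrmN nrm_cIm.
Qed.

Lemma nrm_infinitesimal_le w s v : 0 < s -> cle (sc s) (- cIm w) ->
  infinitesimal_le w (nrm v / s) v.
Proof.
move=> s0 sw; have uy := cle_sc_unit s0 sw.
have py : cpos (- cIm w) by apply: cle_cpos sw; apply: cpos_sc; exact: ltW.
have [k [sk kk uk]] := cpos_sqrt_unit py uy; have skV := saV sk uk.
exists k, (k^-1 * v * k^-1); split; rewrite ?sk //.
  by rewrite !mulrA mulrV // mul1r -mulrA mulVr // mulr1.
rewrite (le_trans (nrmM _ _)) //.
rewrite (le_trans (ler_wpM2r (nrm_ge0 _) (nrmM _ _))) //.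
rewrite [nrm k^-1 * _]mulrC -mulrA ler_wpM2l ?nrm_ge0 //.
rewrite -expr2 -nrm_sa_sqr // -invrM // kk; exact: cle_sc_invr.
Qed.

End Metric.

(** * The map h and its contraction property *)

Section Hmap.
Variables (R : realType) (B : cstarAlgType R) (eta : {linear B -> B}) (b : B).
Hypothesis eta_pos : positive_map eta.
Hypothesis b_Hplus : Hplus b.
Implicit Types (u v w : B) (s t r : R).

Local Notation h := (hmap eta b).
Local Notation M := (nrm (cIm b)^-1).
Local Notation E := (opnorm eta).

Lemma Hminus_cpos w : Hminus w -> cpos (- cIm w).
Proof.
by move=> [e e0 ew]; apply: cle_cpos ew; apply: cpos_sc; exact: ltW.
Qed.

Lemma cIm_b_unit : cIm b \is a GRing.unit.
Proof. by case: b_Hplus => e e0; exact: cle_sc_unit. Qed.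

Lemma nrm_invIm_gt0 : 0 < M.
Proof. exact/nrmV_gt0/cIm_b_unit. Qed.

Lemma cIm_b_ge : cle (sc M^-1) (cIm b).
Proof.
apply: cle_nrm_invr cIm_b_unit; case: b_Hplus => e e0 eb.
by apply: cle_cpos eb; apply: cpos_sc; exact: ltW.
Qed.

Lemma one_le_nrm_b : 1 <= nrm b * M.
Proof.
rewrite -(nrm1 B) -(mulrV cIm_b_unit) (le_trans (nrmM _ _)) //.
by rewrite ler_wpM2r ?nrm_ge0 // nrm_cIm.
Qed.

Lemma nrm_b_gt0 : 0 < nrm b.
Proof.
have := one_le_nrm_b; rewrite lt0r nrm_ge0 andbT.
by case: eqP => // ->; rewrite mul0r ler10.
Qed.

Lemma cIm_den w : cIm (b - eta w) = cIm b + eta (- cIm w).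
Proof. by rewrite cImB -positive_map_cIm // linearN. Qed.

Lemma den_ge w : cpos (- cIm w) -> cle (sc M^-1) (cIm (b - eta w)).
Proof.
move=> pw; apply: cle_trans cIm_b_ge _.
by rewrite cIm_den /cle addrC addKr; exact: eta_pos.
Qed.

Lemma den_unit w : cpos (- cIm w) -> b - eta w \is a GRing.unit.
Proof. by move=> /den_ge; apply: cIm_gt0_unit; rewrite invr_gt0 nrm_invIm_gt0. Qed.

Lemma nrm_h_le w : cpos (- cIm w) -> nrm (h w) <= M.
Proof.
move=> /den_ge; rewrite -[leRHS]invrK; apply: nrm_invr_cIm.
by rewrite invr_gt0 nrm_invIm_gt0.
Qed.

Lemma den_bound_gt0 r : 0 <= r -> 0 < nrm b + r * E.
Proof. by move=> r0; rewrite ltr_wpDr ?nrm_b_gt0 // mulr_ge0 // opnorm_ge0. Qed.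

Lemma h_ge r w : cpos (- cIm w) -> nrm w <= r ->
  cle (sc (M^-1 * (nrm b + r * E) ^- 2)) (- cIm (h w)).
Proof.
move=> pw wr; have r0 : 0 <= r := le_trans (nrm_ge0 w) wr.
have M0 : 0 < M^-1 by rewrite invr_gt0 nrm_invIm_gt0.
apply: (cIm_invr_ge M0 (den_ge pw) (ltW M0) (den_ge pw) (den_bound_gt0 r0)).
rewrite (le_trans (nrmB _ _)) // lerD2l (le_trans (nrm_opnorm eta_pos _)) //.
by rewrite mulrC ler_wpM2r // opnorm_ge0.
Qed.

Lemma h_Hminus w : cpos (- cIm w) -> Hminus (h w).
Proof.
move=> pw; exists (M^-1 * (nrm b + nrm w * E) ^- 2); last exact: h_ge.
by rewrite mulr_gt0 ?invr_gt0 ?nrm_invIm_gt0 // exprn_gt0 // den_bound_gt0 ?nrm_ge0.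
Qed.

Lemma h_sub w w' : b - eta w \is a GRing.unit -> b - eta w' \is a GRing.unit ->
  h w - h w' = h w * eta (w - w') * h w'.
Proof.
move=> uw uw'.
have -> : eta (w - w') = (b - eta w') - (b - eta w) by rewrite linearB; nc_ring.
by rewrite mulrBr mulrBl mulVr // mul1r -mulrA mulrV // mulr1.
Qed.

Definition dh w v : B := h w * eta v * h w.

Fact dh_is_linear w : linear (dh w).
Proof.
by move=> a u v; rewrite /dh linearP mulrDr mulrDl -scalerAr -scalerAl.
Qed.

HB.instance Definition _ w := GRing.isLinear.Build _ _ _ _ (dh w) (dh_is_linear w).

(** By the resolvent identity [h_sub], the remainder is
    [h (w + v) * eta v * h w * eta v * h w]. *)
Lemma deriv_h w : b - eta w \is a GRing.unit -> deriv_at h w (dh w).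
Proof.
move=> uw; set K := nrm (h w); have E0 : 0 <= E := opnorm_ge0 eta_pos.
have K0 : 0 < K by exact: nrmV_gt0.
have etaE v : nrm (eta v) <= E * nrm v := nrm_opnorm eta_pos v.
split.
  exists (K * E * K) => v; rewrite (le_trans (nrmM _ _)) // mulrAC.
  rewrite ler_wpM2r ?nrm_ge0 // (le_trans (nrmM _ _)) // -mulrA ler_pM2l //.
move=> e e0.
have D1 : 0 < 2 * K * (E + 1) by rewrite !mulr_gt0 // ltr_wpDl.
have D2 : 0 < 2 * K ^+ 3 * (E + 1) ^+ 2.
  by rewrite !mulr_gt0 ?exprn_gt0 // ltr_wpDl.
exists (Num.min (2 * K * (E + 1))^-1 (e / (2 * K ^+ 3 * (E + 1) ^+ 2))).
  by rewrite lt_min invr_gt0 D1 divr_gt0.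
move=> v; rewrite lt_min => /andP [v1 v2].
have ev : nrm (eta v) <= (E + 1) * nrm v.
  by rewrite (le_trans (etaE v)) // ler_wpM2r ?nrm_ge0 // lerDl.
have Kev : K * nrm (eta v) <= 2^-1.
  rewrite -(ler_pM2l (_ : 0 < 2)) // mulfV // mulrA.
  rewrite (le_trans (ler_wpM2l _ ev)) ?mulr_ge0 ?(ltW K0) // mulrA mulrC.
  by rewrite -ler_pdivlMr // div1r ltW.
set c := b - eta w in uw.
have cE : b - eta (w + v) = c * (1 - c^-1 * eta v).
  by rewrite mulrBr mulr1 mulrA mulrV // mul1r linearD /c; nc_ring.
have uc' : b - eta (w + v) \is a GRing.unit.
  rewrite cE unitrMr //; apply: neumann.
  rewrite (le_lt_trans (nrmM _ _)) // (le_lt_trans Kev) //.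
  by rewrite invf_lt1 // ltr1n.
have hv := h_sub uc' uw; rewrite [w + v]addrC addrK in hv.
have hvn : nrm (h (v + w)) <= 2 * K.
  have e1 : h (v + w) = h w + h (v + w) * eta v * h w by rewrite -hv [RHS]addrC subrK.
  have : nrm (h (v + w)) <= K + nrm (h (v + w)) * 2^-1.
    rewrite {1}e1 (le_trans (nrmD _ _)) // lerD // -mulrA (le_trans (nrmM _ _)) //.
    rewrite ler_wpM2l ?nrm_ge0 // (le_trans (nrmM _ _)) // mulrC //.
  lra.
rewrite [w + v]addrC hv.
have -> : h (v + w) * eta v * h w - dh w v
    = h (v + w) * eta v * h w * eta v * h w by rewrite /dh -!mulrBl hv.
rewrite (le_trans (nrmM _ _)) //.
apply: (@le_trans _ _ (2 * K * nrm (eta v) * K * nrm (eta v) * K)).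
  rewrite ler_wpM2r ?nrm_ge0 // (le_trans (nrmM _ _)) // ler_wpM2r ?nrm_ge0 //.
  rewrite (le_trans (nrmM _ _)) // ler_wpM2r ?nrm_ge0 // (le_trans (nrmM _ _)) //.
  by rewrite ler_wpM2r ?nrm_ge0.
have -> : 2 * K * nrm (eta v) * K * nrm (eta v) * K
    = 2 * K ^+ 3 * nrm (eta v) ^+ 2 by ring.
apply: (@le_trans _ _ (2 * K ^+ 3 * ((E + 1) * nrm v) ^+ 2)).
  rewrite ler_pM2l ?mulr_gt0 ?exprn_gt0 // ler_pXn2r ?nnegrE ?nrm_ge0 //.
  by rewrite mulr_ge0 ?nrm_ge0 // addr_ge0.
have -> : 2 * K ^+ 3 * ((E + 1) * nrm v) ^+ 2
  = (2 * K ^+ 3 * (E + 1) ^+ 2) * nrm v * nrm v by ring.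
rewrite ler_wpM2r ?nrm_ge0 // mulrC -ler_pdivlMr // ltW //.
Qed.

(** The solution of [kappa / M = (1 - kappa) * (E * r)]: the bounds
    [M^-1 <= cIm b] and [eta y <= E * r] then give
    [eta y <= kappa * (cIm b + eta y)]. *)
Definition kappa r : R := M * E * r / (1 + M * E * r).

Lemma MEr_ge0 r : 0 <= r -> 0 <= M * E * r.
Proof. by move=> r0; rewrite !mulr_ge0 ?nrm_ge0 ?opnorm_ge0. Qed.

Lemma kappa_ge0 r : 0 <= r -> 0 <= kappa r.
Proof. by move=> r0; rewrite divr_ge0 ?MEr_ge0 // addr_ge0 ?MEr_ge0. Qed.

Lemma kappa_lt1 r : 0 <= r -> kappa r < 1.
Proof.
move=> r0; have x0 := MEr_ge0 r0.
by rewrite ltr_pdivrMr ?mul1r; [lra|rewrite ltr_wpDr].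
Qed.

Lemma eta_le_kappa r y : cpos y -> nrm y <= r ->
  cle (eta y) (sc (kappa r) * (cIm b + eta y)).
Proof.
move=> py yr; have r0 := le_trans (nrm_ge0 y) yr; have M0 := nrm_invIm_gt0.
have x0 := MEr_ge0 r0; have x1 : 0 < 1 + M * E * r by rewrite ltr_wpDr.
have k0 := kappa_ge0 r0; have k1 := kappa_lt1 r0.
have kE : kappa r * M^-1 = (1 - kappa r) * (E * r).
  by rewrite /kappa; field; rewrite !gt_eqF.
have ey : cle (eta y) (sc (E * r)).
  apply: cle_nrm; first exact/cpos_sa/eta_pos.
  by rewrite (le_trans (nrm_opnorm eta_pos y)) // ler_wpM2l ?opnorm_ge0.
rewrite /cle.
have -> : sc (kappa r) * (cIm b + eta y) - eta y
  = sc (kappa r) * (cIm b - sc M^-1) + sc (1 - kappa r) * (sc (E * r) - eta y).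
  by rewrite !mulrBr -!scM kE scM scB sc1; nc_ring.
apply: cposD; apply: cposZ => //; first exact: cIm_b_ge.
by rewrite subr_ge0 ltW.
Qed.

(** Conjugating [eta] by [a] on the inside and by the inverse square root [k^-1]
    of [cIm (b - eta w)] on the outside gives a positive map [phi] with
    [phi 1 <= kappa]. The inversion adds only the unitary factor [U] that relates
    the two factorisations of [- cIm (h w)] by [k * c^-1] and [c^-1 * k]. *)
Lemma dh_contracts r w t v : Hminus w -> nrm w <= r -> 0 <= t ->
  infinitesimal_le w t v -> infinitesimal_le (h w) (kappa r * t) (dh w v).
Proof.
move=> Hw wr t0 [a [x [ua wa vE xt]]].
have pw := Hminus_cpos Hw; have uc := den_unit pw.
have r0 := le_trans (nrm_ge0 w) wr.
set c := b - eta w in uc.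
have M0 : 0 < M^-1 by rewrite invr_gt0 nrm_invIm_gt0.
have ceV := den_ge pw; rewrite -/c in ceV.
have uV := cle_sc_unit M0 ceV.
have pV : cpos (cIm c) by apply: cle_cpos ceV; apply: cpos_sc; exact: ltW.
have [k [sk kk uk]] := cpos_sqrt_unit pV uV; have skV := saV sk uk.
pose phi z := k^-1 * eta (star a * z * a) * k^-1.
have phi_lin : linear phi.
  move=> l y z; rewrite /phi mulrDr mulrDl -scalerAr -scalerAl.
  by rewrite linearP mulrDr mulrDl -scalerAr -scalerAl.
pose F : {linear B -> B} := HB.pack phi (GRing.isLinear.Build _ _ _ _ phi phi_lin).
have F_pos : positive_map F.
  move=> z pz; rewrite /F /= /phi -{1}skV; apply/cpos_conj/eta_pos/cpos_conj.
  exact: pz.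
have F1 : cle (F 1) (sc (kappa r)).
  rewrite /F /= /phi mulr1 -wa.
  have := eta_le_kappa pw (_ : nrm (- cIm w) <= r).
  rewrite nrmN (le_trans (nrm_cIm w)) // -cIm_den -/c => /(_ isT) /(cle_conj k^-1).
  rewrite skV !mulrA -(scC (kappa r) k^-1) -!mulrA -kk -(mulrA k) mulrV //.
  by rewrite mulr1 mulVr // mulr1.
have Fx : nrm (F x) <= kappa r * t.
  rewrite (le_trans (russo_dye F_pos x (kappa_ge0 r0) F1)) //.
  by rewrite ler_wpM2l // kappa_ge0.
pose a' := k * c^-1.
have ua' : a' \is a GRing.unit by rewrite unitrMl ?unitrV.
have sa' : star a' = star c^-1 * k by rewrite starM sk.
have a'a' : star a' * a' = - cIm (h w).
  by rewrite sa' /a' mulrA -(mulrA _ k k) kk /hmap -/c cIm_invr.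
pose U := star a'^-1 * (c^-1 * k).
have UU : U * star U = 1.
  have -> : U * star U = star a'^-1 * (c^-1 * (k * k) * star c^-1) * a'^-1.
    by rewrite /U !starM starK sk !mulrA.
  rewrite kk -cIm_invr_swap // -[c^-1]/(h w) -a'a' mulrA starKV // mul1r.
  exact: mulrV.
have U1 : nrm U = 1.
  apply/eqP; have /eqP := nrm_starMr U; rewrite UU nrm1 eq_sym sqrf_eq1.
  by case/orP => // /eqP; have := nrm_ge0 U; lra.
exists a', (U * F x); split => //.
  rewrite /U !mulrA starVK // mul1r /F /= /phi /dh -vE /hmap -/c /a'.
  by rewrite -!mulrA (mulrA k k^-1) mulrV // mul1r (mulrA k^-1 k) mulVr // mul1r.
by rewrite (le_trans (nrmM _ _)) // U1 mul1r.
Qed.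

Lemma iter_h_cpos w n : cpos (- cIm w) -> cpos (- cIm (iter n h w)).
Proof. by move=> pw; elim: n => [//|n IH] /=; exact/Hminus_cpos/h_Hminus. Qed.

Lemma iter_h_Hminus w n : Hminus w -> Hminus (iter n h w).
Proof.
by move=> pw; elim: n => [//|n IH] /=; exact/h_Hminus/Hminus_cpos.
Qed.

Lemma nrm_iter_h r w n : M <= r -> Hminus w -> nrm w <= r ->
  nrm (iter n h w) <= r.
Proof.
move=> Mr Hw wr; case: n => [//|n] /=; apply: le_trans Mr.
exact/nrm_h_le/Hminus_cpos/iter_h_Hminus.
Qed.

Lemma deriv_iter r w n : M <= r -> Hminus w -> nrm w <= r ->
  exists2 L, deriv_at (iter n h) w L & forall t v, 0 <= t ->
    infinitesimal_le w t v ->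
    infinitesimal_le (iter n h w) (kappa r ^+ n * t) (L v).
Proof.
move=> Mr Hw wr; have r0 := le_trans (nrm_ge0 w) wr.
elim: n => [|n [L dL cL]].
  exists idfun; last by move=> t v _; rewrite expr0 mul1r.
  split; first by exists 1 => v; rewrite mul1r.
  move=> e e0; exists 1 => // v _.
  have -> : iter 0 h (w + v) - iter 0 h w - idfun v = 0 by rewrite /=; nc_ring.
  by rewrite nrm0 mulr_ge0 ?nrm_ge0 // ltW.
have Hn := iter_h_Hminus n Hw.
exists (dh (iter n h w) \o L).
  apply: (@deriv_comp _ _ _ _ (iter n h) h) => //.
  exact/deriv_h/den_unit/Hminus_cpos.
move=> t v t0 vt; rewrite exprS -mulrA /=.
apply: dh_contracts => //; first exact: nrm_iter_h.
  by rewrite mulr_ge0 // exprn_ge0 // kappa_ge0.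
exact: cL.
Qed.

Lemma iter_lipschitz r s w w' n : M <= r -> 0 < s ->
  cle (sc s) (- cIm w) -> nrm w <= r -> cle (sc s) (- cIm w') -> nrm w' <= r ->
  nrm (iter n.+1 h w' - iter n.+1 h w)
    <= M * kappa r ^+ n.+1 / s * nrm (w' - w).
Proof.
move=> Mr s0 sw wr sw' wr'; have r0 := le_trans (nrm_ge0 w) wr.
set u := w' - w.
have -> : w' = w + u by rewrite addrC subrK.
apply: mean_value => p /andP [p0 p1].
have q0 : 0 <= 1 - p by rewrite subr_ge0.
have E1 : w + sc p * u = sc (1 - p) * w + sc p * w'.
  by rewrite scB sc1 /u; nc_ring.
rewrite E1; set x := sc (1 - p) * w + sc p * w'.
have sx : cle (sc s) (- cIm x).
  rewrite cImD !cImZ opprD -!mulrN.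
  have -> : sc s = sc (1 - p) * sc s + sc p * sc s :> B.
    by rewrite -!scM -scD; congr sc; ring.
  by apply: cleD; apply: cleZ.
have Hx : Hminus x by exists s.
have xr : nrm x <= r.
  rewrite (le_trans (nrmD _ _)) // !nrm_scM !ger0_norm //.
  have -> : r = (1 - p) * r + p * r by ring.
  by apply: lerD; apply: ler_wpM2l.
have [L dL cL] := deriv_iter n.+1 Mr Hx xr; exists L => //.
have us0 : 0 <= nrm u / s by rewrite divr_ge0 ?nrm_ge0 // ltW.
have := infinitesimal_le_nrm (cL _ _ us0 (nrm_infinitesimal_le u s0 sx)).
move=> /le_trans; apply.
have -> : M * kappa r ^+ n.+1 / s * nrm u = M * (kappa r ^+ n.+1 * (nrm u / s)).
  by rewrite !mulrA mulrAC.
apply: ler_wpM2r; first by rewrite mulr_ge0 // exprn_ge0 // kappa_ge0.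
exact/nrm_h_le/Hminus_cpos/iter_h_Hminus.
Qed.

(** Two fixed points stay at the same distance under the iteration. *)
Lemma fixed_point_unique w w' : Hminus w -> h w = w -> Hminus w' -> h w' = w' ->
  w = w'.
Proof.
move=> Hw hw Hw' hw'.
case: (Hw) => s s0 sw; case: (Hw') => s' s'0 sw'.
pose d := Num.min s s'; have d0 : 0 < d by rewrite lt_min s0.
have dw : cle (sc d) (- cIm w).
  by apply: cle_trans sw; apply: cle_sc; rewrite ge_min lexx.
have dw' : cle (sc d) (- cIm w').
  by apply: cle_trans sw'; apply: cle_sc; rewrite ge_min lexx orbT.
have wM : nrm w <= M by rewrite -hw; exact/nrm_h_le/Hminus_cpos.
have wM' : nrm w' <= M by rewrite -hw'; exact/nrm_h_le/Hminus_cpos.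
have k0 := kappa_ge0 (ltW nrm_invIm_gt0); have k1 := kappa_lt1 (ltW nrm_invIm_gt0).
apply: (@nlim_unique _ _ (fun=> w') _ _ _ (nlim_cst _)).
apply: (@nlim_dominated _ _ _ _ (fun n => M / d * nrm (w' - w) * kappa M ^+ n)).
  move=> n; have it v m : h v = v -> iter m h v = v.
    by move=> hv; elim: m => //= m ->.
  have := iter_lipschitz n (lexx M) d0 dw wM dw' wM'.
  rewrite !it // => /le_trans; apply.
  have -> : M * kappa M ^+ n.+1 / d * nrm (w' - w)
      = M / d * nrm (w' - w) * kappa M ^+ n * kappa M by rewrite exprS; ring.
  rewrite ler_piMr ?(ltW k1) // !mulr_ge0 ?nrm_ge0 ?invr_ge0 ?(ltW d0) //.
  exact: exprn_ge0.
rewrite -(mulr0 (M / d * nrm (w' - w))); apply: cvgM; first exact: cvg_cst.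
by apply: cvg_expr; rewrite ger0_norm.
Qed.

Lemma cpos_nlim (u : nat -> B) l : (forall n, cpos (u n)) -> nlim u l -> cpos l.
Proof.
move=> pu ul; apply/cposP.
have sl : star l = l.
  have := nlim_star ul; under eq_fun do rewrite (cpos_sa (pu _)).
  by move=> ul'; exact: nlim_unique ul' ul.
apply: npos_closed => s s0.
have /cvgrPdist_lt /(_ s s0) [N _ HN] :
  (fun n => nrm (u n - l)) @ \oo --> (0 : R) := ul.
have := HN N (leqnn N); rewrite /= sub0r normrN ger0_norm ?nrm_ge0 // => uN.
have /cposP pN := pu N.
have -> : sc s + l = u N + (sc s - (u N - l)) by nc_ring.
apply: nposD => //; apply: npos_subsc; last exact: ltW.
by rewrite starB (cpos_sa (pu N)) sl.
Qed.

(** The increments of the iteration form a geometric series of ratio [kappa r].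
    The limit lies in the open half-plane because all iterates satisfy the same
    bound [s <= - cIm], a closed condition. *)
Lemma iterates_cvg r w0 : M <= r -> (h @` Dset r) w0 ->
  let s := M^-1 * (nrm b + r * E) ^- 2 in
  exists l, [/\ Hminus l, h l = l & forall n,
    nrm (iter n.+1 h w0 - l)
      <= M / s * (M * E * r) * nrm (h w0 - w0) * kappa r ^+ n].
Proof.
move=> Mr [x [Hx xr] <-] s; set w1 := h x.
have r0 : 0 <= r := le_trans (nrm_ge0 _) Mr.
have k0 := kappa_ge0 r0; have k1 := kappa_lt1 r0.
have s0 : 0 < s by rewrite mulr_gt0 ?invr_gt0 ?exprn_gt0 ?den_bound_gt0 ?nrm_invIm_gt0.
have H1 : Hminus w1 by exact/h_Hminus/Hminus_cpos.
have sn n : cle (sc s) (- cIm (iter n h w1)).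
  rewrite /w1 -iterSr /=; apply: h_ge.
    exact/iter_h_cpos/Hminus_cpos.
  by apply: nrm_iter_h => //; exact: ltW.
have rn n : nrm (iter n h w1) <= r.
  apply: nrm_iter_h => //; rewrite (le_trans _ Mr) //.
  exact/nrm_h_le/Hminus_cpos.
pose C := M / s * nrm (h w1 - w1).
have C0 : 0 <= C by rewrite !mulr_ge0 ?nrm_ge0 // invr_ge0 ltW.
have K1 : 0 < 1 - kappa r by rewrite subr_gt0.
have kk : kappa r / (1 - kappa r) = M * E * r.
  have x1 : 0 < 1 + M * E * r by rewrite ltr_wpDr // MEr_ge0.
  rewrite /kappa; field; rewrite gt_eqF //=.
  have -> : 1 + M * E * r - M * E * r = 1 by ring.
  exact: oner_neq0.
have [n|n|l ul hl] := @nrm_dominated_cvg R B (fun n => iter n.+1 h w1)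
    (fun n => - (C * kappa r ^+ n.+1 / (1 - kappa r))) 0.
- have := iter_lipschitz n Mr s0 (sn 0) (rn 0) (sn 1) (rn 1).
  rewrite /= -iterSr /= => /le_trans; apply.
  rewrite le_eqVlt; apply/orP; left; apply/eqP; rewrite /C !exprS.
  by field; rewrite !gt_eqF.
- by rewrite oppr_le0 mulr_ge0 ?invr_ge0 ?(ltW K1) // mulr_ge0 // exprn_ge0.
have sl : cle (sc s) (- cIm l).
  apply: (@cpos_nlim (fun n => - cIm (iter n.+1 h w1) - sc s)).
    by move=> n; exact: sn.
  apply: nlimB; last exact: nlim_cst.
  apply: nlimN; rewrite cImE; under eq_fun do rewrite cImE.
  apply: nlimM; first exact: nlim_cst.
  apply: nlimM; first exact: nlim_cst.
  by apply: nlimB => //; exact: nlim_star.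
have Hl : Hminus l by exists s.
exists l; split => //.
  apply: (@nlim_unique _ _ (fun n => h (iter n.+1 h w1))); last exact: (nlim_shift ul).
  apply: (@nlim_dominated _ _ _ _ (fun n => M * E * M * nrm (iter n.+1 h w1 - l))).
    move=> n; have pn : cpos (- cIm (iter n.+1 h w1)) by exact/iter_h_cpos/Hminus_cpos.
    have pl := Hminus_cpos Hl.
    rewrite h_sub ?den_unit // (le_trans (nrmM _ _)) // [leRHS]mulrAC.
    apply: ler_pM; rewrite ?nrm_ge0 ?nrm_h_le // (le_trans (nrmM _ _)) // -mulrA.
    by apply: ler_pM; rewrite ?nrm_ge0 ?nrm_h_le ?nrm_opnorm.
  rewrite -(mulr0 (M * E * M)); apply: cvgM; first exact: cvg_cst.
  exact: ul.
move=> n; rewrite (le_trans (hl n)) // sub0r opprK le_eqVlt; apply/orP; left.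
by apply/eqP; rewrite -kk /C exprS; ring.
Qed.

End Hmap.

(** * Noncrossing pairings of an interval *)

Section NoncrossingPairings.
Variable k : nat.
Implicit Types (pi : {set {set 'I_k}}) (V W : {set 'I_k}) (x y m : 'I_k).
Implicit Types (i j : nat).

(** All intervals use the point names of the ambient ['I_k], so that pairings of
    subintervals are combined without relabelling. *)
Definition ncpair i j pi : bool :=
  [&& finset.partition pi [set x : 'I_k | (i <= x < j)%N]%SET,
      [forall V in pi, #|V| == 2%N] & noncrossing pi].

Lemma set2_lt_inj x y x' y' : (x < y)%N -> (x' < y')%N ->
  [set x; y]%SET = [set x'; y']%SET -> x = x' /\ y = y'.
Proof.
move=> xy xy' e.
have /set2P hx : x \in [set x'; y']%SET by rewrite -e set21.
have /set2P hy : y \in [set x'; y']%SET by rewrite -e set22.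
by case: hx xy => ->; case: hy => ->; rewrite ?ltnn // => h;
  move: (ltn_trans h xy'); rewrite ltnn.
Qed.

Lemma ncpairP i j pi : reflect
  [/\ forall V, V \in pi -> exists x y,
        [/\ V = [set x; y]%SET, (x < y)%N, (i <= x)%N & (y < j)%N],
      forall x, (i <= x < j)%N -> exists2 V, V \in pi & x \in V,
      forall V W x, V \in pi -> W \in pi -> x \in V -> x \in W -> V = W
    & forall x y x' y', [set x; y]%SET \in pi -> [set x'; y']%SET \in pi ->
        (x < x')%N -> (x' < y)%N -> (y < y')%N -> False]
  (ncpair i j pi).
Proof.
apply: (iffP and3P) => [[/and3P [/eqP cov triv n0] card nc]|[bl cov inj nc]].
  have bl V : V \in pi -> exists x y,
        [/\ V = [set x; y]%SET, (x < y)%N, (i <= x)%N & (y < j)%N].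
    move=> Vpi; have /forallP /(_ V) := card; rewrite Vpi /= =>
      /cards2P [x [y [xy VE]]].
    have sub z : z \in V -> (i <= z < j)%N.
      move=> zV; have : z \in finset.cover pi by apply/finset.bigcupP; exists V.
      by rewrite cov inE.
    have /andP [x1 x2] : (i <= x < j)%N by apply: sub; rewrite VE set21.
    have /andP [y1 y2] : (i <= y < j)%N by apply: sub; rewrite VE set22.
    have [lt|lt|/val_inj e] := ltngtP x y.
    - by exists x, y; split.
    - by exists y, x; split => //; rewrite VE finset.setUC.
    - by rewrite e eqxx in xy.
  have inj V W x : V \in pi -> W \in pi -> x \in V -> x \in W -> V = W.
    move=> Vp Wp xV xW.
    by rewrite -(def_pblock triv Vp xV) -(def_pblock triv Wp xW).
  split; [exact: bl| |exact: inj|].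
    move=> x xij; have : x \in finset.cover pi by rewrite cov inE.
    by case/finset.bigcupP => V Vp xV; exists V.
  move=> x y x' y' V W xx' x'y yy'.
  have /forallP /(_ x) /forallP /(_ x') /forallP /(_ y) /forallP /(_ y') := nc.
  move=> /forallP /(_ [set x; y]%SET); rewrite V /=.
  move=> /forallP /(_ [set x'; y']%SET); rewrite W /= xx' x'y yy' !set21 !set22 /=.
  move=> /eqP /set2_lt_inj [||e _].
  - exact: ltn_trans x'y.
  - exact: ltn_trans yy'.
  - by rewrite e ltnn in xx'.
split.
- apply/and3P; split.
  + apply/eqP/finset.setP => x; rewrite inE; apply/finset.bigcupP/idP =>
      [[V Vp xV]|/cov [V]].
      have [y [z [VE yz iy zj]]] := bl _ Vp.
      move: xV; rewrite VE => /set2P [->|->]; rewrite ?iy ?zj ?andbT /=; lia.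
    by exists V.
  + apply/finset.trivIsetP => V W Vp Wp; apply: contraR => /pred0Pn [x /andP [xV xW]].
    by apply/eqP; exact: (inj _ _ x).
  + by apply/negP => /bl [x [y [/finset.setP /(_ x)]]]; rewrite !inE eqxx.
- apply/forallP => V; apply/implyP => /bl [x [y [-> xy _ _]]].
  by rewrite cards2; have -> : x != y by apply/eqP => e; rewrite e ltnn in xy.
- apply/forallP => i1; apply/forallP => j1; apply/forallP => i2; apply/forallP => j2.
  apply/forallP => V; apply/implyP => Vp; apply/forallP => W; apply/implyP => Wp.
  apply/implyP => /and5P [l1 l2 l3 iV /and3P [i2V jW j2W]].
  have pair U x y : U \in pi -> x \in U -> y \in U -> (x < y)%N ->
      [set x; y]%SET \in pi.
    move=> Up; have [a [b [UE ab _ _]]] := bl _ Up; rewrite {1 2}UE.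
    by move=> /set2P [->|->] /set2P [->|->] h; rewrite ?ltnn // in h *;
       rewrite -?UE //; lia.
  have := nc i1 i2 j1 j2 (pair _ _ _ Vp iV i2V (ltn_trans l1 l2)).
  by move=> /(_ (pair _ _ _ Wp jW j2W (ltn_trans l2 l3)) l1 l2 l3).
Qed.

Lemma ncpair_empty i pi : ncpair i i pi = (pi == finset.set0).
Proof.
apply/idP/eqP => [/ncpairP [bl _ _ _]|->].
  apply/finset.setP => V; rewrite inE; apply/negP => /bl [x [y [_ xy ix yi]]]; lia.
apply/ncpairP; split.
- by move=> V; rewrite inE.
- by move=> x; lia.
- by move=> V W x; rewrite inE.
- by move=> x y x' y'; rewrite inE.
Qed.

Lemma NC2E : NC2 k = [set pi | ncpair 0 k pi]%SET.
Proof.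
apply/finset.setP => pi; rewrite !inE /ncpair.
suff -> : [set x : 'I_k | (0 <= x < k)%N]%SET = [set: 'I_k]%SET by [].
by apply/finset.setP => x; rewrite !inE ltn_ord.
Qed.

Section Decomposition.
Variables (i0 : 'I_k) (j : nat).

Definition glue m (p : {set {set 'I_k}} * {set {set 'I_k}}) : {set {set 'I_k}} :=
  [set i0; m]%SET |: (p.1 :|: p.2).

Definition split_at m pi : {set {set 'I_k}} * {set {set 'I_k}} :=
  ([set V in pi | V \subset [set x : 'I_k | (i0 < x < m)%N]]%SET,
   [set V in pi | V \subset [set x : 'I_k | (m < x < j)%N]]%SET).

Lemma ncpair_partner pi : (i0 < j)%N -> ncpair i0 j pi ->
  exists m, (i0 < m < j)%N && ([set i0; m]%SET \in pi).
Proof.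
move=> ij /ncpairP [bl cov _ _].
have [|V Vp iV] := cov i0; first by rewrite leqnn.
have [x [y [VE xy ix yj]]] := bl _ Vp.
exists y; move: iV; rewrite VE => /set2P [e|e].
  by rewrite e xy yj -VE.
by rewrite e in ix; lia.
Qed.

Lemma ncpair_partner_uniq pi m m' : ncpair i0 j pi -> (i0 < m)%N -> (i0 < m')%N ->
  [set i0; m]%SET \in pi -> [set i0; m']%SET \in pi -> m = m'.
Proof.
move=> /ncpairP [_ _ inj _] im im' Vp Wp.
have := inj _ _ i0 Vp Wp; rewrite !set21 => /(_ isT isT) /set2_lt_inj e.
by case: e.
Qed.

Variable m : 'I_k.
Hypothesis imj : (i0 < m < j)%N.

Lemma glue_ncpair p : ncpair i0.+1 m p.1 -> ncpair m.+1 j p.2 ->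
  ncpair i0 j (glue m p).
Proof.
move=> /ncpairP [bl1 cov1 inj1 nc1] /ncpairP [bl2 cov2 inj2 nc2].
have gP V : V \in glue m p -> [\/ V = [set i0; m]%SET, V \in p.1 | V \in p.2].
  by rewrite !inE => /or3P [/eqP|?|?]; [constructor 1|constructor 2|constructor 3].
have in1 V x : V \in p.1 -> x \in V -> (i0 < x < m)%N.
  by move=> /bl1 [a [b [-> ab ia bm]]] /set2P [->|->]; lia.
have in2 V x : V \in p.2 -> x \in V -> (m < x < j)%N.
  by move=> /bl2 [a [b [-> ab ia bm]]] /set2P [->|->]; lia.
have reg V x : V \in glue m p -> x \in V ->
  [\/ V = [set i0; m]%SET /\ (x = i0 :> nat \/ x = m :> nat),
      V \in p.1 /\ (i0 < x < m)%N | V \in p.2 /\ (m < x < j)%N].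
  move=> /gP [VE|Vp|Vp] xV.
  - by constructor 1; split => //; move: xV; rewrite VE => /set2P [->|->];
       [left|right].
  - by constructor 2; split => //; exact: in1 xV.
  - by constructor 3; split => //; exact: in2 xV.
apply/ncpairP; split.
- move=> V /gP [->|/bl1 [a [b [-> ab ia bm]]]|/bl2 [a [b [-> ab ia bm]]]].
  + by exists i0, m; split => //; lia.
  + by exists a, b; split => //; lia.
  + by exists a, b; split => //; lia.
- move=> x xij; case: (ltngtP x i0) => [|xi|/val_inj ->]; first by lia.
    case: (ltngtP x m) => [xm|xm|/val_inj ->].
    + have [|V Vp xV] := cov1 x; first by lia.
      by exists V => //; rewrite !inE Vp orbT.
    + have [|V Vp xV] := cov2 x; first by lia.
      by exists V => //; rewrite !inE Vp !orbT.
    + by exists [set i0; m]%SET; rewrite ?set22 // !inE eqxx.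
  by exists [set i0; m]%SET; rewrite ?set21 // !inE eqxx.
- move=> V W x Vg Wg xV xW.
  case: (reg _ _ Vg xV) => -[hV h]; case: (reg _ _ Wg xW) => -[hW h'];
  try (by rewrite hV hW); try (exfalso; lia).
  + exact: (inj1 _ _ x).
  + exact: (inj2 _ _ x).
- move=> x y x' y' Vg Wg l1 l2 l3.
  have reg2 a c : [set a; c]%SET \in glue m p ->
    [\/ (a = i0 :> nat \/ a = m :> nat) /\ (c = i0 :> nat \/ c = m :> nat),
        [/\ [set a; c]%SET \in p.1, (i0 < a < m)%N & (i0 < c < m)%N]
      | [/\ [set a; c]%SET \in p.2, (m < a < j)%N & (m < c < j)%N]].
    move=> Ug; case: (reg _ _ Ug (set21 _ _)) => -[hU h].
    - have := set22 a c; rewrite hU => /set2P e; constructor 1; split=> //.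
      by case: e => ->; [left|right].
    - by constructor 2; split => //; exact: (in1 _ _ hU (set22 _ _)).
    - by constructor 3; split => //; exact: (in2 _ _ hU (set22 _ _)).
  case: (reg2 _ _ Vg) => [[hV h]|[hV h g]|[hV h g]];
  case: (reg2 _ _ Wg) => [[hW h']|[hW h' g']|[hW h' g']];
  try (exfalso; lia).
  + exact: (nc1 x y x' y').
  + exact: (nc2 x y x' y').
Qed.

(** Noncrossing forces every other block to lie on one side of the partner [m] of
    the first point. *)
Lemma ncpair_split pi : ncpair i0 j pi -> [set i0; m]%SET \in pi ->
  [/\ ncpair i0.+1 m (split_at m pi).1, ncpair m.+1 j (split_at m pi).2
    & glue m (split_at m pi) = pi].
Proof.
move=> /ncpairP [bl cov inj nc] imp.
have reg V : V \in pi -> [\/ V = [set i0; m]%SET,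
    V \in (split_at m pi).1 | V \in (split_at m pi).2].
  move=> Vp; have [x [y [VE xy ix yj]]] := bl _ Vp.
  have [->|Vn] := eqVneq V [set i0; m]%SET; first by constructor 1.
  have no z : z \in V -> (z != i0) && (z != m).
    move=> zV; apply/andP; split; apply: contraNneq Vn => e; apply/eqP;
    apply: (inj _ _ z) => //; rewrite e ?set21 ?set22 //.
  have /andP [xi xm] : (x != i0) && (x != m) by apply: no; rewrite VE set21.
  have /andP [yi ym] : (y != i0) && (y != m) by apply: no; rewrite VE set22.
  have xi' : (i0 < x)%N by rewrite ltn_neqAle ix andbT eq_sym.
  rewrite -!val_eqE /= in xm ym.
  have [ymlt|ymgt|ymeq] := ltngtP y m; last by rewrite ymeq eqxx in ym.
    constructor 2; rewrite inE Vp /=; apply/fintype.subsetP => z;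
    rewrite VE => /set2P [->|->];
    rewrite inE; lia.
  have xm' : (m < x)%N.
    rewrite ltnNge; apply/negP => xlem; apply: (nc i0 m x y) => //.
    - by rewrite -VE.
    - by rewrite ltn_neqAle xm.
  constructor 3; rewrite inE Vp /=; apply/fintype.subsetP => z;
  rewrite VE => /set2P [->|->];
  rewrite inE; lia.
have s1 V : V \in (split_at m pi).1 -> V \in pi /\
    forall x, x \in V -> (i0 < x < m)%N.
  rewrite inE => /andP [Vp /fintype.subsetP sub]; split=> // x /sub; by rewrite inE.
have s2 V : V \in (split_at m pi).2 -> V \in pi /\
    forall x, x \in V -> (m < x < j)%N.
  rewrite inE => /andP [Vp /fintype.subsetP sub]; split=> // x /sub; by rewrite inE.
split.
- apply/ncpairP; split.
  + move=> V /s1 [Vp sub]; have [x [y [VE xy ix yj]]] := bl _ Vp.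
    exists x, y; split => //.
      by have := sub x; rewrite VE set21 => /(_ isT); lia.
    by have := sub y; rewrite VE set22 => /(_ isT); lia.
  + move=> x xim; have [|V Vp xV] := cov x; first by lia.
    exists V => //; case: (reg _ Vp) => // [VE|/s2 [_ /(_ _ xV)]]; last by lia.
    by move: xV; rewrite VE => /set2P [e|e]; rewrite e in xim; lia.
  + by move=> V W x /s1 [Vp _] /s1 [Wp _]; exact: inj.
  + by move=> x y x' y' /s1 [Vp _] /s1 [Wp _]; exact: nc.
- apply/ncpairP; split.
  + move=> V /s2 [Vp sub]; have [x [y [VE xy ix yj]]] := bl _ Vp.
    exists x, y; split => //.
    by have := sub x; rewrite VE set21 => /(_ isT); lia.
  + move=> x xim; have [|V Vp xV] := cov x; first by lia.
    exists V => //; case: (reg _ Vp) => // [VE|/s1 [_ /(_ _ xV)]]; last by lia.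
    by move: xV; rewrite VE => /set2P [e|e]; rewrite e in xim; lia.
  + by move=> V W x /s2 [Vp _] /s2 [Wp _]; exact: inj.
  + by move=> x y x' y' /s2 [Vp _] /s2 [Wp _]; exact: nc.
- apply/finset.setP => V; apply/idP/idP.
    by rewrite !inE => /or3P [/eqP -> //|/andP []//|/andP []//].
  by move=> /reg [->|h|h]; rewrite /glue finset.in_setU1 finset.in_setU ?eqxx ?h ?orbT.
Qed.

Lemma split_glue p : ncpair i0.+1 m p.1 -> ncpair m.+1 j p.2 ->
  split_at m (glue m p) = p.
Proof.
move=> n1 n2; have g := glue_ncpair n1 n2.
move: n1 n2 => /ncpairP [bl1 _ _ _] /ncpairP [bl2 _ _ _].
have sub (a b : nat) x y : (x < y)%N ->
    ([set x; y]%SET \subset [set z : 'I_k | (a < z < b)%N]%SET)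
    = (a < x)%N && (y < b)%N.
  move=> xy; apply/fintype.subsetP/andP => [h|[h1 h2] z].
    have := h x; have := h y; rewrite !set21 !set22 !inE => /(_ isT) ? /(_ isT) ?; lia.
  by move=> /set2P [->|->]; rewrite inE; lia.
case: p bl1 bl2 g => p1 p2 /= bl1 bl2 g; congr pair; apply/finset.setP => V;
  rewrite inE; apply/andP/idP => [[]|Vp].
- rewrite !inE => /or3P [/eqP -> |//|/bl2 [x [y [-> xy mx yj]]]]; rewrite sub //; lia.
- have [x [y [VE xy ix ym]]] := bl1 _ Vp.
  by rewrite finset.in_setU1 finset.in_setU Vp orbT; split => //;
     rewrite VE sub //; lia.
- rewrite !inE => /or3P [/eqP -> |/bl1 [x [y [-> xy mx yj]]]|//]; rewrite sub //; lia.
- have [x [y [VE xy ix ym]]] := bl2 _ Vp.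
  by rewrite finset.in_setU1 finset.in_setU Vp !orbT; split => //;
     rewrite VE sub //; lia.
Qed.


End Decomposition.

(** A noncrossing pairing amounts to the partner [m] of its first point [i0] and
    the pairings that it induces between [i0] and [m] and after [m]. *)
Lemma sum_ncpair (V : nmodType) (F : {set {set 'I_k}} -> V) (i0 : 'I_k) j :
  (i0 < j)%N ->
  \sum_(pi | ncpair i0 j pi) F pi =
  \sum_(m : 'I_k | (i0 < m < j)%N) \sum_(p1 | ncpair i0.+1 m p1)
     \sum_(p2 | ncpair m.+1 j p2) F (glue i0 m (p1, p2)).
Proof.
move=> ij.
rewrite (eq_bigr (fun pi =>
  \sum_(m : 'I_k | (i0 < m < j)%N && ([set i0; m]%SET \in pi)) F pi)); last first.
  move=> pi ncpi; have [m mP] := ncpair_partner ij ncpi.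
  rewrite (big_pred1 m) // => m'; apply/idP/eqP => [|-> //].
  move=> /andP [/andP [im' _] mp']; case/andP: mP => /andP [im _] mp.
  exact: (ncpair_partner_uniq ncpi im' im mp' mp).
rewrite (exchange_big_dep (fun m : 'I_k => (i0 < m < j)%N)) /=; last first.
  by move=> pi m _ /andP [].
apply: eq_bigr => m imj; rewrite pair_big_dep /=.
rewrite (reindex_onto (glue i0 m) (split_at i0 j m)) /=; last first.
  by move=> pi /andP [ncpi /andP [_ mp]]; case: (ncpair_split imj ncpi mp).
apply: eq_big => [[p1 p2]|[p1 p2] _] //=.
apply/idP/andP => [/andP [/andP [ng /andP [_ mg]] /eqP e]|[n1 n2]].
  by case: (ncpair_split imj ng mg); rewrite e => h1 h2 _; split; [exact h1|exact h2].
have g := @glue_ncpair i0 j m imj (p1, p2) n1 n2.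
have sg := @split_glue i0 j m imj (p1, p2) n1 n2.
by rewrite g sg imj eqxx /glue finset.in_setU1 eqxx.
Qed.

End NoncrossingPairings.

(** * Moments of a semicircular element *)

Section Reduction.
Variables (R : realType) (B : cstarAlgType R) (eta : {linear B -> B}) (c : B).

Fixpoint ncmoment_fuel f n : B :=
  if f is f'.+1 then
    if n is n'.+1 then
      \sum_(p < n') eta (c * ncmoment_fuel f' p) * c * ncmoment_fuel f' (n' - p).-1
    else 1
  else 0.

(** The sum of the words [eta_pi pi 1 [:: c; ..; c]] over the noncrossing
    pairings [pi] of [n] points, through its recursion on the partner of the
    first point. *)
Definition ncmoment n : B := ncmoment_fuel n.+1 n.

Lemma ncmoment_fuelE f n : (n < f)%N -> ncmoment_fuel f n = ncmoment n.
Proof.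
elim/ltn_ind: n f => n IH [//|f] nf; rewrite /ncmoment /=.
case: n IH nf => [//|n] IH nf; apply: eq_bigr => p _.
have pn := ltn_ord p.
by rewrite (IH p) ?(IH (n - p).-1) ?(IH p _ n.+1) ?(IH (n - p).-1 _ n.+1) //; lia.
Qed.

Lemma ncmoment0 : ncmoment 0 = 1.
Proof. by []. Qed.

Lemma ncmomentS n :
  ncmoment n.+1 = \sum_(p < n) eta (c * ncmoment p) * c * ncmoment (n - p).-1.
Proof.
transitivity (\sum_(p < n) eta (c * ncmoment_fuel n.+1 p) * c
                * ncmoment_fuel n.+1 (n - p).-1); first by [].
apply: eq_bigr => p _; have pn := ltn_ord p.
by rewrite !ncmoment_fuelE //; lia.
Qed.

Section Interval.
Variable k : nat.
Implicit Types (pi Pi : {set {set 'I_k}}) (i j : nat) (m : 'I_k).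

Definition dots i j : seq ('I_k * B) :=
  [seq (p, c) | p <- pmap insub (iota i (j - i))].

Lemma dots_cat i (m : nat) j : (i <= m)%N -> (m <= j)%N ->
  dots i j = dots i m ++ dots m j.
Proof.
move=> im mj; rewrite /dots.
have -> : (j - i = (m - i) + (j - m))%N by lia.
by rewrite iotaD subnKC // pmap_cat map_cat.
Qed.

Lemma dots1 (m : 'I_k) : dots m m.+1 = [:: (m, c)].
Proof. by rewrite /dots subSnn /= valK. Qed.

Lemma dots_split (i m : 'I_k) j : (i < m < j)%N ->
  dots i j = (i, c) :: dots i.+1 m ++ (m, c) :: dots m.+1 j.
Proof.
move=> imj; rewrite (@dots_cat i i.+1) ?dots1; [|lia|lia].
rewrite (@dots_cat i.+1 m); [|lia|lia].
by rewrite (@dots_cat m m.+1) ?dots1; [|lia|lia].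
Qed.

Lemma dots_enum : dots 0 k = zip (enum 'I_k) (nseq k c).
Proof.
rewrite /dots subn0.
have -> : pmap insub (iota 0 k) = enum 'I_k.
  apply: (inj_map val_inj); rewrite val_enum_ord pmap_filter; last exact: insubK.
  by apply/all_filterP/allP => x; rewrite mem_iota isSome_insub.
have -> : nseq k c = nseq (size (enum 'I_k)) c by rewrite size_enum_ord.
by elim: (enum 'I_k) => //= x s <-.
Qed.

Definition reduction_step Pi (u : B * seq ('I_k * B)) :=
  remove_block eta Pi u.1 u.2.

(** The larger pairing [Pi], the coefficient [b0] and the tail [rest] are
    universal so that the reductions of consecutive and nested intervals
    compose. The clause on the intermediate words serves the nested ones: as
    long as the first remaining position lies strictly inside a block, the left
    end of that block cannot be matched with it. *)
Definition reduces i j pi (x : B) : Prop :=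
  ~~ odd (j - i) /\
  forall Pi b0 rest, finset.trivIset Pi -> pi \subset Pi ->
    (forall t, (t < (j - i)./2)%N -> exists b p d l,
       iter t (reduction_step Pi) (b0, dots i j ++ rest) = (b, (p, d) :: l)
       /\ (i <= p < j)%N)
    /\ iter (j - i)./2 (reduction_step Pi) (b0, dots i j ++ rest) = (b0 * x, rest).

Lemma reduces_empty i : reduces i i finset.set0 1.
Proof.
split; first by rewrite subnn.
by move=> Pi b0 rest _ _; rewrite /dots subnn mulr1.
Qed.

Lemma remove_block_cons Pi b0 b1 b2 (i p : 'I_k) l :
  remove_block eta Pi b0 ((i, b1) :: (p, b2) :: l) =
  if [set i; p]%SET \in Pi then (b0 * eta b1 * b2, l)
  else let: (c', l') := remove_block eta Pi b1 ((p, b2) :: l) in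
       (b0, (i, c') :: l').
Proof. by []. Qed.

Lemma iter_reduction_lift Pi (i : 'I_k) b0 c0 l n :
  (forall t, (t < n)%N -> exists b p d l',
     iter t (reduction_step Pi) (c0, l) = (b, (p, d) :: l')
     /\ [set i; p]%SET \notin Pi) ->
  iter n (reduction_step Pi) (b0, (i, c0) :: l) =
  (b0, (i, (iter n (reduction_step Pi) (c0, l)).1)
        :: (iter n (reduction_step Pi) (c0, l)).2).
Proof.
elim: n => [//|n IH] H; rewrite !iterS IH => [|t tn]; last first.
  by apply: H; exact: ltn_trans tn _.
have [b [p [d [l' [-> /negPf np]]]]] := H n (leqnn _).
rewrite /reduction_step [in LHS]/fst [in LHS]/snd remove_block_cons np.
by case: remove_block.
Qed.

(** The removals run through the points between [i] and [m], then the block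
    of [i] and [m], whose ends have become neighbours, then the points after
    [m]. *)
Lemma reduces_glue (i m : 'I_k) j p x1 x2 : (i < m < j)%N ->
  reduces i.+1 m p.1 x1 -> reduces m.+1 j p.2 x2 ->
  reduces i j (glue i m p) (eta (c * x1) * c * x2).
Proof.
move=> imj [odd1 r1] [odd2 r2].
have jiE : (j - i = (j - m.+1) + (2 + (m - i.+1)))%N by lia.
have halfE : ((j - i)./2 = (j - m.+1)./2 + (1 + (m - i.+1)./2))%N.
  by rewrite jiE halfD (negPf odd2).
split; first by rewrite jiE !oddD (negPf odd1) (negPf odd2).
move=> Pi b0 rest triv sub.
have sub1 : p.1 \subset Pi.
  apply/fintype.subsetP => V h; apply: (fintype.subsetP sub).
  by rewrite finset.in_setU1 finset.in_setU h orbT.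
have sub2 : p.2 \subset Pi.
  apply/fintype.subsetP => V h; apply: (fintype.subsetP sub).
  by rewrite finset.in_setU1 finset.in_setU h !orbT.
have imPi : [set i; m]%SET \in Pi.
  by apply: (fintype.subsetP sub); rewrite finset.in_setU1 eqxx.
set W := dots i.+1 m ++ ((m, c) :: dots m.+1 j ++ rest).
have -> : dots i j ++ rest = (i, c) :: W.
  by rewrite (dots_split imj) /W /= -catA.
have [h1 e1] := r1 Pi c ((m, c) :: dots m.+1 j ++ rest) triv sub1.
rewrite -/W in h1 e1.
have [h2 e2] := r2 Pi (b0 * eta (c * x1) * c) rest triv sub2.
have lift n : (n <= (m - i.+1)./2)%N ->
  iter n (reduction_step Pi) (b0, (i, c) :: W) =
  (b0, (i, (iter n (reduction_step Pi) (c, W)).1)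
        :: (iter n (reduction_step Pi) (c, W)).2).
  move=> n1; apply: iter_reduction_lift => t tn.
  have [b [q [d [l [-> qb]]]]] := h1 t (leq_trans tn n1).
  exists b, q, d, l; split => //; apply/negP => iq.
  have e : [set i; q]%SET = [set i; m]%SET.
    by rewrite -(def_pblock triv iq (set21 _ _)) -(def_pblock triv imPi (set21 _ _)).
  have [iq' im] : (i < q)%N /\ (i < m)%N by lia.
  have [_ qm] := set2_lt_inj iq' im e.
  by rewrite qm in qb; lia.
have mid : iter (1 + (m - i.+1)./2) (reduction_step Pi) (b0, (i, c) :: W)
   = (b0 * eta (c * x1) * c, dots m.+1 j ++ rest).
  by rewrite iterD lift // e1 /= /reduction_step /= imPi.
split; last by rewrite halfE iterD mid e2 !mulrA.
move=> t tlt; have [tle|tgt] := leqP t (m - i.+1)./2.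
  rewrite lift //; do 4!eexists; split; first by reflexivity.
  by lia.
have -> : (t = (t - (1 + (m - i.+1)./2)) + (1 + (m - i.+1)./2))%N by lia.
rewrite iterD mid.
have [|b [q [d [l [-> qb]]]]] := h2 (t - (1 + (m - i.+1)./2))%N; first by lia.
by exists b, q, d, l; split => //; lia.
Qed.

Definition reduced_value i j pi : B :=
  (iter (j - i)./2 (reduction_step pi) (1, dots i j)).1.

Lemma reduced_valueE i j pi x : ncpair i j pi -> reduces i j pi x ->
  reduced_value i j pi = x.
Proof.
move=> /and3P [/and3P [_ triv _] _ _] [_ /(_ pi 1 [::] triv (subxx _)) [_]].
by rewrite cats0 /reduced_value => ->; rewrite mul1r.
Qed.

Lemma reduced_value_sum i j : (i <= j)%N -> (j <= k)%N ->
  (forall pi, ncpair i j pi -> reduces i j pi (reduced_value i j pi)) /\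
  \sum_(pi | ncpair i j pi) reduced_value i j pi = ncmoment (j - i).
Proof.
move En : (j - i)%N => n; elim/ltn_ind: n i j En => n IH i j ijn ij jk.
move: ij; rewrite leq_eqVlt => /orP [/eqP eij|ij].
  rewrite -eij subnn in ijn; rewrite -ijn -eij; split.
    move=> pi nc; have r := reduces_empty i; move: (nc).
    rewrite ncpair_empty => /eqP e; rewrite e in nc *.
    by rewrite (reduced_valueE nc r).
  rewrite (big_pred1 finset.set0) => [|pi]; last exact: ncpair_empty.
  by rewrite /reduced_value subnn /dots subnn.
have ik : (i < k)%N by exact: leq_trans jk.
pose i0 := Ordinal ik.
have in1 m : (i0 < m < j)%N -> (forall pi, ncpair i.+1 m pi ->
     reduces i.+1 m pi (reduced_value i.+1 m pi)) /\
    \sum_(pi | ncpair i.+1 m pi) reduced_value i.+1 m pi = ncmoment (m - i.+1).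
  by move=> /= imj; apply: (IH (m - i.+1)%N) => //; lia.
have in2 m : (i0 < m < j)%N -> (forall pi, ncpair m.+1 j pi ->
     reduces m.+1 j pi (reduced_value m.+1 j pi)) /\
    \sum_(pi | ncpair m.+1 j pi) reduced_value m.+1 j pi = ncmoment (j - m.+1).
  by move=> /= imj; apply: (IH (j - m.+1)%N) => //; lia.
have gl m p1 p2 : (i0 < m < j)%N -> ncpair i.+1 m p1 -> ncpair m.+1 j p2 ->
    reduces i0 j (glue i0 m (p1, p2))
      (eta (c * reduced_value i.+1 m p1) * c * reduced_value m.+1 j p2).
  move=> imj n1 n2; apply: reduces_glue => //=.
    by case: (in1 m imj) => h _; exact: h.
  by case: (in2 m imj) => h _; exact: h.
split.
  move=> pi nc; have [m /andP [imj mpi]] := @ncpair_partner _ i0 j pi ij nc.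
  have [n1 n2 e] := @ncpair_split _ i0 j m imj pi nc mpi.
  have := gl m _ _ imj n1 n2; rewrite -surjective_pairing e => r.
  by rewrite (reduced_valueE nc r).
rewrite (@sum_ncpair _ _ _ i0 j ij) /=.
have -> : n = n.-1.+1 by lia.
rewrite ncmomentS.
pose G q := eta (c * ncmoment q) * c * ncmoment (n.-1 - q).-1.
transitivity (\sum_(m : 'I_k | (i < m < j)%N) G (m - i.+1)%N).
  apply: eq_bigr => m imj.
  transitivity (\sum_(p1 | ncpair i.+1 m p1) \sum_(p2 | ncpair m.+1 j p2)
     eta (c * reduced_value i.+1 m p1) * c * reduced_value m.+1 j p2).
    apply: eq_bigr => p1 n1; apply: eq_bigr => p2 n2.
    apply: (reduced_valueE _ (gl m p1 p2 imj n1 n2)).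
    exact (@glue_ncpair _ i0 j m imj (p1, p2) n1 n2).
  under eq_bigr do rewrite -mulr_sumr (proj2 (in2 m imj)).
  rewrite -mulr_suml -mulr_suml -linear_sum -mulr_sumr (proj2 (in1 m imj)).
  by rewrite /G; congr (_ * ncmoment _); lia.
rewrite -(big_mkord (fun m : nat => (i < m < j)%N) (fun m : nat => G (m - i.+1)%N)).
rewrite -(big_mkord predT G).
have -> : \big[+%R/0]_(0 <= m' < k | (i < m' < j)%N) G (m' - i.+1)%N
   = \sum_(i.+1 <= m' < j) G (m' - i.+1)%N.
  rewrite [RHS](big_nat_widen _ _ k) // [RHS](big_nat_widenl _ 0) //.
  by apply: eq_bigl => m; rewrite /= andbC.
rewrite -{1}(add0n i.+1) big_addn.
have -> : (j - i.+1 = n.-1)%N by lia.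
by apply: eq_bigr => q _; rewrite addnK.
Qed.

Lemma eta_pi_sum :
  \sum_(pi in NC2 k) eta_pi eta pi 1 (nseq_tuple k c) = ncmoment k.
Proof.
have [_] := reduced_value_sum (leq0n k) (leqnn k); rewrite subn0 => <-.
rewrite NC2E; apply: eq_big => [pi|pi _]; first by rewrite inE.
by rewrite /eta_pi /reduced_value subn0 dots_enum.
Qed.

End Interval.

Lemma semicircular_moment (A : ovspace B) (s : A) n : semicircular eta s ->
  ovE A ((s * ovemb A c) ^+ n) = ncmoment n.
Proof.
move=> [_ /(_ n 1 (nseq_tuple n c))]; rewrite eta_pi_sum rmorph1 => <-.
congr (ovE A _) => /=; elim: n => [//|n IH].
rewrite exprSr IH -addn1 nseqD foldl_cat /= mulrA.
by [].
Qed.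

End Reduction.

(** * The Cauchy transform of a semicircular element *)

(** A function whose iterated difference quotients [F n] at [0] are geometrically
    bounded, and which vanishes on the right of [0], vanishes on the left too:
    all its Taylor coefficients are zero, and [F 0 z = z ^+ n * F n z]. *)
Lemma vanish_left (R : realType) (B : cstarAlgType R) (F : nat -> R -> B)
    (d C L : R) :
  (forall n z, - d <= z -> F n z = F n 0 + sc z * F n.+1 z) ->
  (forall n z, - d <= z -> nrm (F n z) <= C * L ^+ n) -> 0 <= d -> 0 <= L ->
  (forall z, 0 <= z -> F 0 z = 0) ->
  forall z, - d <= z -> `|z| * L <= 2^-1 -> F 0 z = 0.
Proof.
move=> FE FC d0 L0 F0; have dz z : 0 <= z -> - d <= z by move=> z0; lra.
have C0 : 0 <= C.
  by have := FC 0 0 (dz _ (lexx _)); rewrite expr0 mulr1;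
    apply: le_trans; exact: nrm_ge0.
have Fn n z : 0 <= z -> F n z = 0.
  elim: n z => [|n IH] z z0; first exact: F0.
  have pos y : 0 < y -> F n.+1 y = 0.
    move=> y0; have := FE n y (dz _ (ltW y0)).
    rewrite !IH ?(ltW y0) // add0r => /esym e.
    by apply: (mulrI (sc_unit B (lt0r_neq0 y0))); rewrite e mulr0.
  move: z0; rewrite le_eqVlt => /orP [/eqP <-|/pos //].
  apply/nrm0_eq0/eqP; rewrite eq_le nrm_ge0 andbT; apply/ler_addgt0Pr => e e0.
  have D0 : 0 < C * L ^+ n.+2 + 1 by rewrite ltr_wpDl // mulr_ge0 // exprn_ge0.
  pose y := e / (C * L ^+ n.+2 + 1); have y0 : 0 < y by exact: divr_gt0.
  have := FE n.+1 y (dz _ (ltW y0)); rewrite pos // => /esym/eqP.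
  rewrite addr_eq0 => /eqP ->; rewrite nrmN nrm_scM gtr0_norm // add0r.
  rewrite (le_trans (ler_wpM2l (ltW y0) (FC _ _ (dz _ (ltW y0))))) //.
  by rewrite /y mulrAC ler_pdivrMr // ler_pM2l // lerDl.
move=> z zd zL.
have Fz n : F 0 z = sc (z ^+ n) * F n z.
  elim: n => [|n ->]; first by rewrite expr0 sc1 mul1r.
  by rewrite (FE n z zd) Fn // add0r mulrA -scM -exprSr.
apply: (@nlim_unique _ _ (fun=> F 0 z) _ _ (nlim_cst _)).
apply: (@nlim_dominated _ _ _ _ (fun n => C * 2^-1 ^+ n)).
  move=> n; rewrite subr0 (Fz n) nrm_scM normrX.
  rewrite (le_trans (ler_wpM2l _ (FC n z zd))) ?exprn_ge0 //.
  rewrite mulrCA -exprMn ler_wpM2l // lerXn2r ?nnegrE ?mulr_ge0 ?invr_ge0 //.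
rewrite -(mulr0 C); apply: cvgM; first exact: cvg_cst.
by apply: cvg_expr; rewrite ger0_norm ?invr_ge0 // invf_lt1 // ltr1n.
Qed.

Section CauchyTransform.
Variables (R : realType) (B : cstarAlgType R) (eta : {linear B -> B}).
Hypothesis eta_pos : positive_map eta.
Variables (A : ovspace B) (s : A).
Hypothesis s_semi : semicircular eta s.

Local Notation emb := (ovemb A).
Local Notation Ev := (ovE A).

Let s_sa : star s = s. Proof. by case: s_semi. Qed.

Lemma emb_sc t : emb (sc t) = sc t.
Proof. by rewrite /sc linearZ rmorph1. Qed.

Lemma emb_ii : emb ii = ii.
Proof. by rewrite /ii linearZ rmorph1. Qed.

Lemma Ev1 : Ev 1 = 1.
Proof. by rewrite -(rmorph1 emb) ovE_id. Qed.

Lemma Ev_sc t : Ev (sc t) = sc t.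
Proof. by rewrite -emb_sc ovE_id. Qed.

Lemma nrm_Ev x : nrm (Ev x) <= nrm x.
Proof.
by have := positive_map_bounded (@ovE_pos _ _ A) x; rewrite Ev1 nrm1 mul1r.
Qed.

Lemma Ev_embl d x : Ev (emb d * x) = d * Ev x.
Proof. by have := ovE_bimod d 1 x; rewrite rmorph1 !mulr1. Qed.

Lemma emb_pos : positive_map emb.
Proof. by move=> x [y ->]; exists (emb y); rewrite rmorphM /= ovemb_star. Qed.

Lemma cIm_emb_sub d : cIm (emb d - s) = emb (cIm d).
Proof.
rewrite cImB (cIm_real s_sa) subr0 /cIm [RHS]linearZ -ovemb_star.
by congr (_ *: _); rewrite linearB.
Qed.

Lemma cle_emb_sub d t : cle (sc t) (cIm d) -> cle (sc t) (cIm (emb d - s)).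
Proof.
by rewrite cIm_emb_sub /cle -(emb_sc t) -linearB /=; exact: emb_pos.
Qed.

Lemma cauchy_transform_Hminus d : Hplus d -> Hminus (cauchy_transform s d).
Proof.
move=> [t t0 td]; have ct := cle_emb_sub td.
have uc := cIm_gt0_unit t0 ct.
have N0 : 0 < nrm (emb d - s) + 1 by rewrite ltr_wpDl ?nrm_ge0.
have := cIm_invr_ge t0 ct (ltW t0) ct N0 (_ : _ <= _); rewrite lerDl => /(_ ler01).
move=> h; eexists; last first.
  rewrite /cauchy_transform -(positive_map_cIm (@ovE_pos _ _ A)) -linearN.
  by have := @ovE_pos _ _ A _ h; rewrite linearB /= Ev_sc; exact.
by rewrite mulr_gt0 // invr_gt0 exprn_gt0.
Qed.

Definition schwinger_dyson d : Prop :=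
  Ev (s * (emb d - s)^-1)
  = eta (cauchy_transform s d) * cauchy_transform s d.

Lemma schwinger_dysonP d : Hplus d -> schwinger_dyson d ->
  d * cauchy_transform s d
  = 1 + eta (cauchy_transform s d) * cauchy_transform s d.
Proof.
move=> [t t0 td] <-; rewrite /cauchy_transform -Ev_embl -Ev1 -linearD.
congr (Ev _); have uc := cIm_gt0_unit t0 (cle_emb_sub td).
by rewrite -[1](mulrV uc) -mulrDl subrK.
Qed.

(** For small [d^-1] the two sides are power series in [s * emb d^-1], whose
    coefficients agree by the recursion on noncrossing pairings. *)
Lemma schwinger_dyson_large d : d \is a GRing.unit ->
  nrm s * nrm d^-1 <= 4^-1 -> schwinger_dyson d.
Proof.
move=> ud small; set c := d^-1; pose a := s * emb c.
set q : R := 4^-1 in small.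
have aq : nrm a <= q by rewrite (le_trans (nrmM _ _)) // ovemb_nrm.
have q1 : q < 1 by rewrite /q; lra.
have u1a : 1 - a \is a GRing.unit by apply: neumann; exact: le_lt_trans q1.
set z := (1 - a)^-1.
have z2 : nrm z <= 2.
  have e : z = 1 + a * z by rewrite -[X in X + _](mulrV u1a) -/z mulrBl mul1r subrK.
  have : nrm z <= 1 + q * nrm z.
    rewrite {1}e (le_trans (nrmD _ _)) // nrm1 lerD2l (le_trans (nrmM _ _)) //.
    by rewrite ler_wpM2r ?nrm_ge0.
  by rewrite /q; lra.
have rE : (emb d - s)^-1 = emb c * z.
  have -> : emb d - s = (1 - a) * emb d.
    by rewrite mulrBl mul1r /a -mulrA -rmorphM mulVr // rmorph1 mulr1.
  by rewrite invrM ?rmorph_unit // -rmorphV.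
have aX n : nrm (a ^+ n) <= q ^+ n.
  by rewrite (le_trans (nrmX _ _)) // lerXn2r ?nnegrE ?nrm_ge0 // /q invr_ge0.
pose v n := ncmoment eta c n.
have vE n : Ev (a ^+ n) = v n by exact: semicircular_moment.
pose V N := \sum_(n < N) v n.
pose rem N := Ev (a ^+ N * z).
have remE N : Ev z = V N + rem N.
  rewrite /V -(eq_bigr _ (fun (n : 'I_N) _ => vE n)) -linear_sum -linearD.
  congr (Ev _).
  apply: (mulIr u1a); rewrite mulrDl -mulrA !mulVr // mulr1.
  elim: N => [|N IH]; first by rewrite big_ord0 mul0r add0r expr0.
  by rewrite big_ord_recr mulrDl -addrA [a ^+ N * _]mulrBr mulr1 -exprSr subrK.
have remn N : nrm (rem N) <= 2 * q ^+ N.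
  rewrite (le_trans (nrm_Ev _)) // (le_trans (nrmM _ _)) // mulrC.
  by rewrite ler_pM ?nrm_ge0.
have vn n : nrm (v n) <= 2 * q ^+ n.
  rewrite -vE (le_trans (nrm_Ev _)) // (le_trans (aX n)) //.
  by rewrite -[leLHS]mul1r ler_wpM2r ?exprn_ge0 ?ler1n // /q invr_ge0.
have v1 : v 1 = 0 by rewrite /v ncmomentS big_ord0.
pose X N := \sum_(p < N) eta (c * v p) * c * V (N - p)%N.
have V1 : V 1 = 1 by rewrite /V big_ord1.
(* The Cauchy product is compared with the triangular sum [X N] instead of a
   square one, because the recursion on [v] sums it exactly. *)
have XE N : X N = V N.+2 - 1.
  elim: N => [|N IH].
    by rewrite /X big_ord0 /V !big_ord_recr big_ord0 /= v1 add0r addr0 subrr.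
  have -> : X N.+1 = X N + v N.+2.
    rewrite /X big_ord_recr /= subSnn V1 mulr1.
    rewrite /v ncmomentS big_ord_recr /= subSnn ncmoment0 mulr1 addrA -big_split /=.
    congr (_ + _); apply: eq_bigr => p _.
    by rewrite subSn ?(ltnW (ltn_ord p)) // /V big_ord_recr mulrDr.
  by rewrite IH [V N.+3]big_ord_recr /= -/(V N.+2) addrAC.
pose E := opnorm eta; have E0 : 0 <= E := opnorm_ge0 eta_pos.
pose D := E * nrm c ^+ 2.
have D0 : 0 <= D by rewrite mulr_ge0 // exprn_ge0 ?nrm_ge0.
have bil x y : nrm (eta (c * x) * c * y) <= D * (nrm x * nrm y).
  rewrite (le_trans (nrmM _ _)) // (le_trans (ler_wpM2r (nrm_ge0 _) (nrmM _ _))) //.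
  have -> : D * (nrm x * nrm y) = E * (nrm c * nrm x) * nrm c * nrm y.
    by rewrite /D; ring.
  rewrite !ler_wpM2r ?nrm_ge0 // (le_trans (nrm_opnorm eta_pos _)) //.
  by rewrite ler_wpM2l // nrmM.
have main : Ev z - 1 = eta (c * Ev z) * c * Ev z.
  apply: (@nlim_unique _ _ (fun N => V N.+2 - 1)).
    apply: (@nlim_dominated _ _ _ _ (fun N => 2 * q ^+ N)).
      move=> N; rewrite (remE N.+2).
      have -> : V N.+2 - 1 - (V N.+2 + rem N.+2 - 1) = - rem N.+2 by nc_ring.
      rewrite nrmN (le_trans (remn _)) // ler_pM2l // !exprS mulrA.
      by rewrite ler_piMl ?exprn_ge0 // /q; lra.
    rewrite -(mulr0 2); apply: cvgM; first exact: cvg_cst.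
    by apply: cvg_expr; rewrite ger0_norm // /q; lra.
  (* There are [N.+1] error terms of size [q ^+ N], and [N.+1 <= 2 ^+ N]. *)
  apply: (@nlim_dominated _ _ _ _ (fun N => 4 * D * 2^-1 ^+ N)).
    move=> N; rewrite -XE nrm_distC.
    have -> : eta (c * Ev z) * c * Ev z - X N
      = \sum_(p < N) eta (c * v p) * c * rem (N - p)%N + eta (c * rem N) * c * Ev z.
      rewrite {1}(remE N) mulrDr linearD mulrDl mulrDl addrAC; congr (_ + _).
      rewrite /V mulr_sumr linear_sum mulr_suml mulr_suml /X -sumrB.
      apply: eq_bigr => p _; rewrite {1}(remE (N - p)%N).
      by rewrite mulrDr addrAC subrr add0r.
    rewrite (le_trans (nrmD _ _)) //.
    apply: (@le_trans _ _ (\sum_(p < N) D * (4 * q ^+ N) + D * (4 * q ^+ N))).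
      apply: lerD.
        rewrite (le_trans (nrm_sum _ _ _)) //; apply: ler_sum => p _.
        rewrite (le_trans (bil _ _)) // ler_wpM2l //.
        have -> : 4 * q ^+ N = 2 * q ^+ p * (2 * q ^+ (N - p)).
          have -> : q ^+ N = q ^+ p * q ^+ (N - p).
            by rewrite -exprD subnKC // ltnW.
          by ring.
        by apply: ler_pM; [exact: nrm_ge0|exact: nrm_ge0|exact: vn|exact: remn].
      rewrite (le_trans (bil _ _)) // ler_wpM2l //.
      have -> : 4 * q ^+ N = 2 * q ^+ N * 2 by ring.
      apply: ler_pM; [exact: nrm_ge0|exact: nrm_ge0|exact: remn|].
      exact: le_trans (nrm_Ev _) _.
    rewrite sumr_const card_ord -mulrSr -[leLHS]mulr_natr.
    have qE : q ^+ N = 2^-1 ^+ N * 2^-1 ^+ N.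
      by rewrite -exprMn; congr (_ ^+ _); rewrite /q; field.
    have -> : D * (4 * q ^+ N) * N.+1%:R
      = 4 * D * 2^-1 ^+ N * (2^-1 ^+ N * N.+1%:R) by rewrite qE; ring.
    apply: ler_piMr.
      by apply: mulr_ge0; [exact: mulr_ge0|rewrite exprn_ge0 // invr_ge0].
    rewrite exprVn mulrC ler_pdivrMr ?exprn_gt0 // mul1r -natrX ler_nat.
    exact: ltn_expl.
  rewrite -(mulr0 (4 * D)); apply: cvgM; first exact: cvg_cst.
  by apply: cvg_expr; rewrite ger0_norm ?invr_ge0 // invf_lt1 // ltr1n.
rewrite /schwinger_dyson /cauchy_transform rE mulrA -/a Ev_embl.
rewrite [RHS]mulrA -main -Ev1 -linearB; congr (Ev _).
by rewrite -[X in _ - X](mulrV u1a) -/z mulrBl mul1r opprB addrC subrK.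
Qed.

(** With [x] the displacement from the height [t1], the resolvent satisfies
    [r x = r 0 + x * P * r x] for [P = - i * r 0], so the iterated difference
    quotients of [r] at [0] are [An n x = P ^+ n * r x]; those of the product
    [eta (g 0 x) * g 0 x] follow by the Leibniz rule. All of them are bounded
    geometrically, uniformly in the height. *)
Lemma schwinger_dyson_left d e t1 t : 0 < e -> cle (sc e) (cIm d) -> 0 <= t1 ->
  (forall t', t1 <= t' -> schwinger_dyson (d + sc t' * ii)) ->
  0 <= t -> t1 - e / 4 <= t -> schwinger_dyson (d + sc t * ii).
Proof.
move=> e0 ed t10 right t0 tt1.
have [/right //|/ltW tt] := leP t1 t.
set K := e^-1; have K0 : 0 < K by rewrite invr_gt0.
pose r x := (emb (d + sc (t1 + x) * ii) - s)^-1.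
have im x : - t1 <= x -> cle (sc e) (cIm (emb (d + sc (t1 + x) * ii) - s)).
  move=> x1; apply: cle_emb_sub; rewrite cImD -iiC cIm_ii ?star_sc //.
  rewrite -[sc e]addr0; apply: cleD => //; rewrite -sc0; apply: cle_sc.
  by lra.
have ur x : - t1 <= x -> emb (d + sc (t1 + x) * ii) - s \is a GRing.unit.
  by move=> /im; exact: cIm_gt0_unit.
have rK x : - t1 <= x -> nrm (r x) <= K by move=> /im; exact: nrm_invr_cIm.
have x0 : - t1 <= 0 by rewrite oppr_le0.
have rE x : - t1 <= x -> r x = r 0 + sc x * (- ii * r 0) * r x.
  move=> x1; have : r 0 - r x = r 0 * (sc x * ii) * r x.
    have -> : sc x * ii = (emb (d + sc (t1 + x) * ii) - s)
                          - (emb (d + sc (t1 + 0) * ii) - s) :> A.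
      by rewrite !rmorphD !rmorphM /= !emb_sc emb_ii !scD sc0; nc_ring.
    by rewrite mulrBr mulrBl mulVr ?ur // mul1r -mulrA mulrV ?ur // mulr1.
  move=> h; rewrite -[LHS](subKr (r 0)) h.
  by rewrite [r 0 * _]mulrA -(scC x (r 0)) -(mulrA (sc x) (r 0)) -(iiC (r 0)); nc_ring.
pose P := - ii * r 0; pose An n x := P ^+ n * r x.
have PK : nrm P <= K by rewrite /P mulNr nrmN nrm_iiM rK.
have AE n x : - t1 <= x -> An n x = An n 0 + sc x * An n.+1 x.
  move=> x1; rewrite /An {1}(rE x x1) mulrDr exprSr; congr (_ + _).
  by rewrite !mulrA scC.
have AK n x : - t1 <= x -> nrm (An n x) <= K ^+ n.+1.
  move=> x1; rewrite (le_trans (nrmM _ _)) // exprSr.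
  apply: ler_pM; rewrite ?nrm_ge0 ?rK // (le_trans (nrmX _ _)) //.
  by rewrite lerXn2r ?nnegrE ?nrm_ge0 // ltW.
pose g n x := Ev (An n x).
have gE n x : - t1 <= x -> g n x = g n 0 + sc x * g n.+1 x.
  by move=> x1; rewrite /g {1}(AE n x x1) linearD linear_scM.
have gK n x : - t1 <= x -> nrm (g n x) <= K ^+ n.+1.
  by move=> x1; rewrite (le_trans (nrm_Ev _)) ?AK.
pose E := opnorm eta; have E0 : 0 <= E := opnorm_ge0 eta_pos.
have egK n m x y : - t1 <= x -> - t1 <= y ->
    nrm (eta (g n x) * g m y) <= E * K ^+ 2 * K ^+ (n + m).
  move=> x1 y1; rewrite (le_trans (nrmM _ _)) //.
  have -> : E * K ^+ 2 * K ^+ (n + m) = E * K ^+ n.+1 * K ^+ m.+1.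
    by rewrite exprD !exprS; ring.
  apply: ler_pM; rewrite ?nrm_ge0 ?gK // (le_trans (nrm_opnorm eta_pos _)) //.
  by rewrite ler_wpM2l ?gK.
pose F n x := Ev (s * An n x) - eta (g n x) * g 0 x
              - \sum_(i < n) eta (g i 0) * g (n - i)%N x.
have FE n x : - t1 <= x -> F n x = F n 0 + sc x * F n.+1 x.
  move=> x1; rewrite /F big_ord_recr /= subSnn.
  have -> : Ev (s * An n x) = Ev (s * An n 0) + sc x * Ev (s * An n.+1 x).
    by rewrite {1}(AE n x x1) mulrDr mulrA -scC -mulrA linearD linear_scM.
  have -> : \sum_(i < n) eta (g i 0) * g (n - i)%N x
    = \sum_(i < n) eta (g i 0) * g (n - i)%N 0
      + sc x * \sum_(i < n) eta (g i 0) * g (n.+1 - i)%N x.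
    rewrite mulr_sumr -big_split; apply: eq_bigr => i _ /=.
    rewrite (gE (n - i)%N x x1) mulrDr subSn ?(ltnW (ltn_ord i)) //.
    by rewrite !mulrA scC.
  have -> : eta (g n x) * g 0 x = eta (g n 0) * g 0 0
      + sc x * (eta (g n.+1 x) * g 0 x + eta (g n 0) * g 1 x).
    rewrite {1}(gE n x x1) linearD linear_scM mulrDl {1}(gE 0 x x1).
    rewrite mulrDr mulrDr !mulrA (scC x (eta (g n 0))) -addrA.
    by rewrite [_ + sc x * _ * _]addrC.
  by nc_ring.
have FK n x : - t1 <= x ->
    nrm (F n x) <= (nrm s * K + E * K ^+ 2) * (2 * K) ^+ n.
  move=> x1; rewrite (le_trans (nrmB _ _)) //.
  have h1 : nrm (Ev (s * An n x) - eta (g n x) * g 0 x)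
      <= nrm s * K * K ^+ n + E * K ^+ 2 * K ^+ n.
    rewrite (le_trans (nrmB _ _)) // lerD //; last first.
      by have := egK n 0%N x x x1 x1; rewrite addn0.
    rewrite (le_trans (nrm_Ev _)) // (le_trans (nrmM _ _)) // -mulrA -exprS.
    by rewrite ler_wpM2l ?nrm_ge0 // AK.
  have h2 : nrm (\sum_(i < n) eta (g i 0) * g (n - i)%N x)
      <= n%:R * (E * K ^+ 2 * K ^+ n).
    rewrite (le_trans (nrm_sum _ _ _)) //.
    apply: (@le_trans _ _ (\sum_(i < n) E * K ^+ 2 * K ^+ n)).
      apply: ler_sum => i _.
      have := egK i (n - i)%N 0 x x0 x1.
      by rewrite subnKC // ltnW.
    by rewrite sumr_const card_ord [leRHS]mulrC mulr_natr.
  apply: (le_trans (lerD h1 h2)).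
  have Kn : 0 <= K ^+ n by rewrite exprn_ge0 // ltW.
  (* The number of Leibniz terms is absorbed into the ratio [2 * K]. *)
  have n2 : n%:R + 1 <= 2 ^+ n :> R.
    by rewrite natr1 -natrX ler_nat ltn_expl.
  have a0 : 0 <= nrm s * K * K ^+ n by rewrite !mulr_ge0 ?nrm_ge0 // ltW.
  have b0 : 0 <= E * K ^+ 2 * K ^+ n by rewrite !mulr_ge0 ?exprn_ge0 ?(ltW K0).
  have -> : (nrm s * K + E * K ^+ 2) * (2 * K) ^+ n
    = 2 ^+ n * (nrm s * K * K ^+ n) + 2 ^+ n * (E * K ^+ 2 * K ^+ n).
    by rewrite exprMn; ring.
  have n0 : 0 <= n%:R :> R by exact: ler0n.
  by nra.
have F0 x : - t1 <= x -> F 0 x = Ev (s * r x) - eta (Ev (r x)) * Ev (r x).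
  by move=> _; rewrite /F big_ord0 subr0 /g /An expr0 !mul1r.
have L0 : 0 <= 2 * K by rewrite mulr_ge0 // ltW.
have right0 x : 0 <= x -> F 0 x = 0.
  move=> x1; rewrite F0; last by lra.
  by apply/eqP; rewrite subr_eq0; apply/eqP/right; rewrite lerDl.
have zt : - t1 <= t - t1 by lra.
have zL : `|t - t1| * (2 * K) <= 2^-1.
  rewrite distrC ger0_norm ?subr_ge0 //.
  have -> : 2^-1 = e / 4 * (2 * K) by rewrite /K; field; rewrite gt_eqF.
  by rewrite ler_wpM2r //; lra.
have := vanish_left FE FK t10 L0 right0 zt zL.
by rewrite F0 // /r [t1 + _]addrC subrK => /subr0_eq.
Qed.

(** The equation holds high up on the vertical half-line above [d], and moves
    down by steps of a fixed length. *)
Lemma semicircular_schwinger_dyson d : Hplus d -> schwinger_dyson d.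
Proof.
move=> [e e0 ed]; pose T := 4 * nrm s + 1.
have T0 : 0 < T by rewrite ltr_wpDl // mulr_ge0 ?nrm_ge0.
have high t : T <= t -> schwinger_dyson (d + sc t * ii).
  move=> Tt; have t0 : 0 < t by exact: lt_le_trans Tt.
  have im : cle (sc t) (cIm (d + sc t * ii)).
    rewrite cImD -iiC cIm_ii ?star_sc // /cle addrK.
    by apply: cle_cpos ed; apply: cpos_sc; exact: ltW.
  apply: schwinger_dyson_large; first exact: cIm_gt0_unit im.
  rewrite (le_trans (ler_wpM2l (nrm_ge0 _) (nrm_invr_cIm t0 im))) //.
  by rewrite ler_pdivrMr //; rewrite /T in Tt; lra.
have down n t : 0 <= t -> T - n%:R * (e / 4) <= t -> schwinger_dyson (d + sc t * ii).
  elim: n t => [|n IH] t t0; first by rewrite mul0r subr0; exact: high.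
  rewrite -[n.+1%:R]natr1 mulrDl mul1r => Tt.
  pose t1 := Num.max 0 (T - n%:R * (e / 4)).
  apply: (@schwinger_dyson_left d e t1) => //.
  - by rewrite le_max lexx.
  - move=> t'; rewrite ge_max => /andP [h1 h2]; exact: IH.
  - by rewrite lerBlDr ge_max; apply/andP; split; lra.
have -> : d = d + sc 0 * ii by rewrite sc0 mul0r addr0.
apply: (down (Num.truncn (T / (e / 4))).+1) => //.
have := truncnS_gt (T / (e / 4)); rewrite ltr_pdivrMr ?divr_gt0 //; lra.
Qed.

Lemma cauchy_transform_equation d : Hplus d ->
  d * cauchy_transform s d
  = 1 + eta (cauchy_transform s d) * cauchy_transform s d.
Proof.
by move=> Hd; apply: schwinger_dysonP => //; exact: semicircular_schwinger_dyson.
Qed.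

End CauchyTransform.

(** * Comparison of the constants and the theorem *)

Section Constants.
Variables (R : realType) (M E r beta : R).
Hypotheses (M0 : 0 < M) (E0 : 0 <= E) (Mr : M < r) (b1 : 1 <= beta * M).

Let N := beta + r * E.
Let eps := Num.min (r - M) (N ^- 2 * M^-1).

Let r0 : 0 < r. Proof. exact: lt_trans Mr. Qed.

Let beta0 : 0 < beta.
Proof. by rewrite -(pmulr_lgt0 _ M0); exact: lt_le_trans b1. Qed.

Let N0 : 0 < N. Proof. by rewrite ltr_wpDr // mulr_ge0 // ltW. Qed.

Let eps0 : 0 < eps.
Proof. by rewrite lt_min subr_gt0 Mr mulr_gt0 ?invr_gt0 // exprn_gt0. Qed.

Let eps_r : eps <= r.
Proof.
have /le_trans : eps <= r - M by rewrite ge_min lexx.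
by apply; rewrite gerBl ltW.
Qed.

Let eps_N : eps <= M^-1 * N ^- 2.
Proof. by rewrite ge_min [M^-1 * _]mulrC lexx orbT. Qed.

(** [4 * E <= 4 * beta * r * E <= N ^+ 2] because [1 <= beta * M <= beta * r]. *)
Lemma ratio_le : M * E * r / (1 + M * E * r) <= (1 + eps / (2 * r))^-1.
Proof.
have x0 : 0 <= M * E * r by rewrite !mulr_ge0 // ltW.
have y0 : 0 <= eps / (2 * r) by rewrite divr_ge0 ?mulr_ge0 // ltW.
have N2 : 0 < N ^+ 2 by rewrite exprn_gt0.
have EN : E <= N ^+ 2.
  have br : 1 <= beta * r.
    by rewrite (le_trans b1) // ler_pM2l // ltW.
  have : 4 * (beta * r * E) <= N ^+ 2.
    by have := sqr_ge0 (beta - r * E); rewrite /N; nra.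
  by nra.
have ME : eps * (M * E) <= 1.
  rewrite (le_trans (ler_wpM2r _ eps_N)) ?mulr_ge0 // ?(ltW M0) //.
  have -> : M^-1 * N ^- 2 * (M * E) = E / N ^+ 2 by field; rewrite !gt_eqF.
  by rewrite ler_pdivrMr // mul1r.
rewrite -[leRHS]div1r ler_pdivrMr ?ltr_wpDr // [leRHS]mulrAC ler_pdivlMr ?ltr_wpDr //.
rewrite mul1r mulrDr mulr1 addrC lerD2r.
have -> : M * E * r * (eps / (2 * r)) = eps * (M * E) / 2 by field; rewrite gt_eqF.
lra.
Qed.

(** Replacing [s = M^-1 * N ^- 2] by [eps] increases the left side, and
    [r <= 4 * r ^+ 2 / eps] since [eps <= r]. *)
Lemma prefactor_le :
  M / (M^-1 * N ^- 2) * (M * E * r) <= (M * (2 * r / eps)) ^+ 2 * E.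
Proof.
have s0 : 0 < M^-1 * N ^- 2 by rewrite mulr_gt0 ?invr_gt0 // exprn_gt0.
apply: (@le_trans _ _ (M / eps * (M * E * r))).
  rewrite ler_wpM2r ?mulr_ge0 ?(ltW M0) ?(ltW r0) // ler_wpM2l ?(ltW M0) //.
  by rewrite lef_pV2 ?posrE.
have re : 1 <= r / eps by rewrite ler_pdivlMr // mul1r.
have -> : M / eps * (M * E * r) = M ^+ 2 * E * (r / eps) by ring.
have -> : (M * (2 * r / eps)) ^+ 2 * E = M ^+ 2 * E * (4 * (r / eps) * (r / eps)).
  by ring.
rewrite ler_wpM2l ?mulr_ge0 ?exprn_ge0 ?(ltW M0) //.
by nra.
Qed.

End Constants.

Theorem corollaryB5 (R : realType) (B : cstarAlgType R)
    (eta : {linear B -> B}) (eta_pos : positive_map eta)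
    (b : B) (b_Hplus : Hplus b) :
  (forall w : B, Hminus w ->
     [/\ b - eta w \is a GRing.unit, Hminus (hmap eta b w)
       & cdifferentiable (hmap eta b) w]) /\
  exists wstar : B,
    [/\ unique (fun w : B => Hminus w /\ hmap eta b w = w) wstar,
        unique (fun w : B => Hminus w /\ b * w = 1 + eta w * w) wstar,
        (forall (A : ovspace B) (s : A),
           semicircular eta s -> wstar = cauchy_transform s b)
      & forall (r : R), nrm (cIm b)^-1 < r ->
        let eps := Num.min (r - nrm (cIm b)^-1)
          ((nrm b + r * opnorm eta) ^- 2 * (nrm (cIm b)^-1)^-1) in
        let q := (1 + eps / (2 * r))^-1 in
        forall (w0 : B), (hmap eta b @` Dset r) w0 ->
        forall n : nat, (1 <= n)%N ->
          nrm (iter n (hmap eta b) w0 - wstar) <=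
            (nrm (cIm b)^-1 * (2 * r / eps)) ^+ 2 * opnorm eta *
            nrm (hmap eta b w0 - w0) * q ^+ n.-1 /\
          nrm (iter n (hmap eta b) w0 - wstar) <=
            (nrm (cIm b)^-1 * (2 * r / eps)) ^+ 2 * opnorm eta *
            nrm (iter n (hmap eta b) w0 - iter n.-1 (hmap eta b) w0)].
Proof.
have M0 := nrm_invIm_gt0 b_Hplus; set M := nrm (cIm b)^-1 in M0 *.
split.
  move=> w Hw; have pw := Hminus_cpos Hw; split.
  - exact: den_unit.
  - exact: h_Hminus.
  - exists (dh eta b w); exact/deriv_h/den_unit.
have [w [Hw hw]] : exists w, Hminus w /\ hmap eta b w = w.
  pose x : B := - (ii * sc M).
  have Hx : Hminus x.
    by exists M => //; rewrite cImN opprK cIm_ii ?star_sc //; exact: cle_refl.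
  have xD : Dset (M + 1) x.
    by split => //; rewrite nrmN nrm_iiM nrm_sc gtr0_norm // ltrDl.
  have Mr : M <= M + 1 by rewrite lerDl.
  have [w [Hw hw _]] := iterates_cvg eta_pos b_Hplus Mr
    (ex_intro2 _ _ x xD (erefl (hmap eta b x))).
  by exists w.
have eqn u : Hminus u -> b * u = 1 + eta u * u -> hmap eta b u = u.
  move=> Hu e; have uu := den_unit eta_pos b_Hplus (Hminus_cpos Hu).
  by apply: (mulrI uu); rewrite mulrV // mulrBl e addrK.
have uniq_w u : Hminus u -> hmap eta b u = u -> w = u.
  by move=> Hu hu; exact: (fixed_point_unique eta_pos b_Hplus Hw hw Hu hu).
exists w; split.
- by split => // u [Hu hu]; exact: uniq_w.
- split; last by move=> u [Hu /(eqn u Hu) hu]; exact: uniq_w.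
  split => //; have uw := den_unit eta_pos b_Hplus (Hminus_cpos Hw).
  have e : (b - eta w) * w = 1 by rewrite -{2}hw /hmap mulrV.
  by rewrite -e mulrBl subrK.
- move=> A s s_semi; apply: uniq_w.
    exact: cauchy_transform_Hminus s_semi _ b_Hplus.
  apply: eqn; first exact: cauchy_transform_Hminus s_semi _ b_Hplus.
  exact: cauchy_transform_equation.
move=> r Mr eps q w0 w0D [//|n] _.
have r0 : 0 < r := lt_trans M0 Mr.
have E0 := opnorm_ge0 eta_pos.
have b1 := one_le_nrm_b b_Hplus.
have pre := prefactor_le M0 E0 Mr b1; rewrite -/eps in pre.
have ratio := ratio_le M0 E0 Mr b1; rewrite -/eps -/q in ratio.
split.
  have [l [Hl hl bound]] := iterates_cvg eta_pos b_Hplus (ltW Mr) w0D.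
  rewrite (uniq_w l Hl hl) (le_trans (bound n)) //.
  have k0 : 0 <= kappa eta b r by apply: kappa_ge0 => //; exact: ltW.
  apply: ler_pM.
  - by rewrite !mulr_ge0 ?nrm_ge0 ?invr_ge0 ?mulr_ge0 ?invr_ge0 ?exprn_ge0
      ?addr_ge0 ?mulr_ge0 ?nrm_ge0 ?(ltW r0).
  - exact: exprn_ge0.
  - by rewrite ler_wpM2r ?nrm_ge0.
  - by rewrite lerXn2r ?nnegrE // (le_trans k0).
have wnD : (hmap eta b @` Dset r) (iter n (hmap eta b) w0).
  case: n => [//|n]; case: w0D => x [Hx xr] <-.
  exists (iter n.+1 (hmap eta b) x); last by rewrite -iterSr.
  split; first exact: iter_h_Hminus.
  by apply: le_lt_trans Mr => /=; apply/nrm_h_le => //;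
     apply/Hminus_cpos/iter_h_Hminus.
have [l [Hl hl bound]] := iterates_cvg eta_pos b_Hplus (ltW Mr) wnD.
have := bound 0; rewrite expr0 mulr1 -(uniq_w l Hl hl) /= => /le_trans; apply.
by rewrite ler_wpM2r ?nrm_ge0.
Qed.
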